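(* There is a universal constant $C$ such that the following holds. Let $\mathcal{X}$ be a measurable space, $n\ge1$, and let $f:\mathcal{X}^n\to\mathbb{R}$ be a measurable map that admits a symmetric interaction rule $G$. Let $X_1,X_2,\dots$ be a sequence of i.i.d. $\mathcal{X}$-valued random variables, $X=(X_1,\dots,X_n)$, $W=f(X)$, and $\sigma^2=\mathrm{Var}(W)$, with $0<\sigma^2<\infty$. Let $X'=(X_1',\dots,X_n')$ be an independent copy of $X$. For each $j\in\{1,\dots,n\}$ let $$\Delta_j f(X)=W-f(X_1,\dots,X_{j-1},X_j',X_{j+1},\dots,X_n),$$ and let $M=\max_j|\Delta_j f(X)|$. Let $G'$ be an arbitrary symmetric extension of $G$ on $\mathcal{X}^{n+4}$ and put $$\delta:=1+\text{degree of the vertex }1\text{ in }G'(X_1,\dots,X_{n+4}).$$ Then $$\delta_W\le \frac{C n^{1/2}}{\sigma^2}\,\mathbb{E}(M^8)^{1/4}\,\mathbb{E}(\delta^4)^{1/4}+\frac{1}{2\sigma^3}\sum_{j=1}^n\mathbb{E}|\Delta_j f(X)|^3 .$$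
   Context: Distance to normality: for a real random variable $W$ with finite second moment and $\mathrm{Var}(W)>0$, $\delta_W:=\mathcal{W}(\mu,\nu)$, where $\mu$ is the law of $(W-\mathbb{E}W)/\sqrt{\mathrm{Var}(W)}$, $\nu$ is the standard Gaussian law, and $\mathcal{W}(\mu,\nu)=\sup\{|\int h\,d\mu-\int h\,d\nu| : h:\mathbb{R}\to\mathbb{R} \text{ Lipschitz with constant}\le 1\}$ is the Kantorovich–Wasserstein distance. Graphical rules: write $[n]=\{1,\dots,n\}$. A graphical rule on $\mathcal{X}^n$ is a map $G$ associating to every $x\in\mathcal{X}^n$ an undirected (simple) graph $G(x)$ on $[n]$ (measurable in the sense that $\{x:\{i,j\}\in G(x)\}$ is measurable for all $i\ne j$). Here $\{i,j\}\in G(x)$ means that $\{i,j\}$ is an edge. $G$ is symmetric if for every permutation $\pi$ of $[n]$ and every $(x_1,\dots,x_n)\in\mathcal{X}^n$, the set of edges of $G(x_{\pi(1)},\dots,x_{\pi(n)})$ is exactly $\{\{i,j\}:\{\pi(i),\pi(j)\}\in G(x_1,\dots,x_n)\}$. Extension: for $m>n$, $x\in\mathcal{X}^n$ is embedded in $y\in\mathcal{X}^m$ if there are distinct $i_1,\dots,i_n\in[m]$ with $x_k=y_{i_k}$ for $1\le k\le n$. A graphical rule $G'$ on $\mathcal{X}^m$ is an extension of $G$ if for every $x\in\mathcal{X}^n$ embedded in $y\in\mathcal{X}^m$ (via indices $i_1,\dots,i_n$), $G(x)$ is the naturally induced subgraph of $G'(y)$, i.e. $\{k,l\}\in G(x)$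 if and only if $\{i_k,i_l\}\in G'(y)$. Interaction rule: for $x,x'\in\mathcal{X}^n$ and distinct $i,j\in[n]$, let $x^i$ be $x$ with $x_i$ replaced by $x_i'$, and $x^{ij}$ be $x$ with $x_i,x_j$ replaced by $x_i',x_j'$. The coordinates $i,j$ are noninteracting under $(f,x,x')$ if $f(x)-f(x^j)=f(x^i)-f(x^{ij})$. A graphical rule $G$ is an interaction rule for $f$ if for all $x,x'\in\mathcal{X}^n$ and distinct $i,j$, whenever $\{i,j\}$ is not an edge in any of $G(x),G(x^i),G(x^j),G(x^{ij})$, the coordinates $i,j$ are noninteracting under $(f,x,x')$. *)

(* Defs.v *)
From HB Require Import structures.
From mathcomp Require Import all_boot all_order all_algebra perm finmap.
From mathcomp Require Import all_classical all_reals all_analysis.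
From mathcomp Require Import measurable_realfun.

Set Implicit Arguments.
Unset Strict Implicit.
Unset Printing Implicit Defensive.

Import Order.TTheory GRing.Theory Num.Theory.
Import numFieldNormedType.Exports.

Local Open Scope classical_set_scope.
Local Open Scope ring_scope.

Section DistanceToNormality.
Local Open Scope ereal_scope.
Context {R : realType}.

Definition kantorovich (mu nu : probability (measurableTypeR R) R) : \bar R :=
  ereal_sup [set `| \int[mu]_x (h x)%:E - \int[nu]_x (h x)%:E |
            | h in [set h : R -> R | 1.-lipschitz h] ].

Context {d : measure_display} {Omega : measurableType d}.
Variable P : probability Omega R.

Definition standardize (W : {RV P >-> R}) : Omega -> measurableTypeR R :=
  fun w => ((W w - fine 'E_P[W]) / Num.sqrt (fine 'V_P[W]))%R.

Lemma measurable_standardize (W : {RV P >-> R}) :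
  measurable_fun [set: Omega] (standardize W).
Proof.
suff : measurable_fun [set: Omega] (standardize W : Omega -> R) by [].
by apply: measurable_funM => //; exact: measurable_funB.
Qed.

HB.instance Definition _ (W : {RV P >-> R}) :=
  isMeasurableFun.Build _ _ _ _ (standardize W) (measurable_standardize W).

Definition distance_to_normality (W : {RV P >-> R}) : \bar R :=
  kantorovich (distribution P (standardize W)) (normal_prob 0%R 1%R).

End DistanceToNormality.

Section Independence.
Local Open Scope ereal_scope.
Context {R : realType} {d : measure_display} {Omega : measurableType d}.
Variable P : probability Omega R.

Definition mutually_independent {d' : measure_display} {T : measurableType d'}
    (I : choiceType) (X : I -> {RV P >-> T}) : Prop :=
  forall (J : {fset I}) (A : I -> set T), (forall i, measurable (A i)) ->
    P (\bigcap_(i in [set` J]) (X i @^-1` A i)) =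
    \prod_(i <- J) P (X i @^-1` A i).

Definition same_law {d' : measure_display} {T : measurableType d'}
    (Y Z : {RV P >-> T}) : Prop :=
  forall A : set T, measurable A -> distribution P Y A = distribution P Z A.

Definition iid {d' : measure_display} {T : measurableType d'}
    (I : choiceType) (X : I -> {RV P >-> T}) : Prop :=
  mutually_independent X /\ forall i j, same_law (X i) (X j).

Definition independent_copy {d' : measure_display} {T : measurableType d'}
    (Y Y' : {RV P >-> T}) : Prop :=
  same_law Y Y' /\
  forall A B : set T, measurable A -> measurable B ->
    P (Y @^-1` A `&` Y' @^-1` B) = P (Y @^-1` A) * P (Y' @^-1` B).

Context {d' : measure_display} {T : measurableType d'}.

(* The random vector of the first [n] terms; indices start at 0. *)
Definition sample (n : nat) (X : nat -> {RV P >-> T}) : Omega -> n.-tuple T :=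
  fun w => [tuple X i w | i < n].
#[global] Arguments sample : clear implicits.

Lemma measurable_sample n (X : nat -> {RV P >-> T}) :
  measurable_fun [set: Omega] (sample n X).
Proof.
apply/measurable_fun_tnthP => i.
rewrite (_ : _ \o _ = X i)//.
by apply/funext => w /=; rewrite tnth_mktuple.
Qed.

HB.instance Definition _ n (X : nat -> {RV P >-> T}) :=
  isMeasurableFun.Build _ _ _ _ (sample n X) (measurable_sample X).

End Independence.

Arguments sample {R d Omega P d' T} n X.

Section GraphicalRules.
Context {d : measure_display} {T : measurableType d}.

Record graphical_rule (n : nat) := GraphicalRule {
  edge :> n.-tuple T -> rel 'I_n ;
  edge_sym : forall x, symmetric (edge x) ;
  edge_irrefl : forall x, irreflexive (edge x) ;
  measurable_edge : forall i j, i != j -> measurable [set x | edge x i j]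
}.

Definition degree n (e : rel 'I_n) (i : 'I_n) : nat := #|[set j | e i j]%SET|.

Definition symmetric_rule n (G : graphical_rule n) : Prop :=
  forall (pi : 'S_n) (x : n.-tuple T) (i j : 'I_n),
    G [tuple tnth x (pi k) | k < n] i j = G x (pi i) (pi j).

Definition embedded_via n m (x : n.-tuple T) (y : m.-tuple T)
    (iota : 'I_n -> 'I_m) : Prop :=
  injective iota /\ forall k, tnth x k = tnth y (iota k).

Definition extension n m (G : graphical_rule n) (G' : graphical_rule m) : Prop :=
  (n < m)%N /\
  forall (x : n.-tuple T) (y : m.-tuple T) (iota : 'I_n -> 'I_m),
    embedded_via x y iota -> forall k l, G x k l = G' y (iota k) (iota l).

(* [x] with the coordinates in [A] replaced by those of [x']. *)
Definition replace n (x x' : n.-tuple T) (A : {set 'I_n}) : n.-tuple T :=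
  [tuple if k \in A then tnth x' k else tnth x k | k < n].

Context {R : realType}.

Definition noninteracting n (f : n.-tuple T -> R) (x x' : n.-tuple T)
    (i j : 'I_n) : Prop :=
  f x - f (replace x x' [set j]%SET) =
  f (replace x x' [set i]%SET) - f (replace x x' [set i; j]%SET).

Definition interaction_rule n (f : n.-tuple T -> R) (G : graphical_rule n) :
    Prop :=
  forall (x x' : n.-tuple T) (i j : 'I_n), i != j ->
    ~~ G x i j ->
    ~~ G (replace x x' [set i]%SET) i j ->
    ~~ G (replace x x' [set j]%SET) i j ->
    ~~ G (replace x x' [set i; j]%SET) i j ->
    noninteracting f x x' i j.

Definition Delta n (f : n.-tuple T -> R) (j : 'I_n) (x x' : n.-tuple T) : R :=
  f x - f (replace x x' [set j]%SET).

(* All the values are nonnegative, so the base value 0 is harmless. *)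
Definition maxDelta n (f : n.-tuple T -> R) (x x' : n.-tuple T) : R :=
  \big[Num.max/0]_(j < n) `|Delta f j x x'|.

End GraphicalRules.

Arguments graphical_rule {d} T n.

(* Main.v *)
Require Import Defs.
From HB Require Import structures.
From mathcomp Require Import all_boot all_order all_algebra perm finmap.
From mathcomp Require Import all_classical all_reals all_analysis.
From mathcomp Require Import measurable_realfun.
From mathcomp Require Import ring lra zify.

Set Implicit Arguments.
Unset Strict Implicit.
Unset Printing Implicit Defensive.

Import Order.TTheory GRing.Theory Num.Theory.
Import numFieldNormedType.Exports.

Local Open Scope classical_set_scope.
Local Open Scope ring_scope.

(* Stein's method with a random replacement set. Let psi solve the Stein equation
   psi' - x psi = h - E h(Z). Let X^A be X with the coordinates in A replaced by
   those of X', and average over a random set A whose law makes the increments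
   f(X^(A\j)) - f(X^(A u j)) telescope to f(X) - f(X'). Exchanging X_j and X'_j
   then gives E g(X) f(X) as half the mean of
     sum_j (g(X) - g(X^j)) (f(X^(A\j)) - f(X^(A u j))).
   With g = psi o f and a Taylor expansion, the distance to normality is bounded by
   the third moments plus the covariance of psi'(f(X)) with
     T_A = 1/2 sum_j (f(X) - f(X^j)) (f(X^(A\j)) - f(X^(A u j))).
   Since psi' is bounded, that covariance is controlled by an Efron-Stein bound on
   Var E(T_A | X). Resampling X_i only affects the terms j = i and those for which
   {i, j} is an edge at one of eight configurations, so each Efron-Stein difference
   is at most M^2 times a number of neighbours of i; the fourth moment of that number
   is compared with that of delta by embedding each configuration in a sample of
   n + 4 points. Averaging over sets A and over all j (rather than j outside A) makes
   the bound uniform in A. *)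

(** * The Stein equation *)

Section SteinEquation.
Context {R : realType}.
Notation mu := (@lebesgue_measure R).
Implicit Types (x y b : R) (f h F : R -> R).

(** Two obstacles shape the argument. The variance of E(T_A | X) is not reached through a
    conditional expectation: it is the covariance of two values of T_A that share X and use
    independent copies of X', and averaging over more and more copies of X' yields the
    Cauchy-Schwarz bound that conditioning would give. All variables therefore live on a space of
    sequences of copies of the sample, where exchange and resampling are injective renamings of
    indices. Second, the neighbours of i are counted in configurations X^j that change with j, so
    their number is not a degree in one graph. Its fourth power expands into products of four edges,
    which involve at most four replaced points; parking the original values in four extra places
    makes all four edges visible in one graph on n + 4 points. The fourth power arises when
    Cauchy-Schwarz separates M^2 from the count in a second moment, which also produces M^8. The
    final constant is 40 because 4^2 * (1/2) * 200 = 40^2, where 4 bounds psi' and 200 comes from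
    the Efron-Stein differences. *)

Lemma is_derive_ndecr F (dF : R -> R) (a b : R) : a <= b ->
  (forall x, is_derive x 1 F (dF x)) -> (forall x, a <= x <= b -> 0 <= dF x) ->
  F a <= F b.
Proof.
move=> ab dFx dF0.
have cF : {within `[a, b], continuous F}.
  by apply: derivable_within_continuous => x _; have [] := dFx x.
have [c] := MVT_segment ab (fun x _ => dFx x) cF.
rewrite in_itv /= => cab e; rewrite -subr_ge0 e mulr_ge0 ?subr_ge0 ?dF0 //.
Qed.

Lemma is_derive_continuous F dF : (forall x, is_derive x 1 F (dF x)) ->
  continuous F.
Proof.
move=> dFx x; apply: differentiable_continuous; apply/derivable1_diffP.
by have [] := dFx x.
Qed.

Definition gauss x : R := normal_pdf 0 1 x.

Lemma gaussE x : gauss x = normal_peak 1 * expR (- x ^+ 2 / 2).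
Proof.
by rewrite /gauss normal_pdfE ?oner_eq0// /normal_fun subr0 expr1n.
Qed.

Lemma gauss_gt0 x : 0 < gauss x.
Proof. by rewrite gaussE mulr_gt0 ?expR_gt0// normal_peak_gt0 ?oner_eq0. Qed.

Lemma is_derive_gauss x : is_derive x 1 gauss (- x * gauss x).
Proof.
have -> : gauss = normal_peak 1 \*: (expR \o (fun x => - 2^-1 * (x ^+ 2))) :> (R -> R).
  by apply/funext => y; rewrite gaussE /=; congr (_ * expR _); field.
have d2 : is_derive x 1 (fun x : R => - 2^-1 * x ^+ 2) (- x).
  have -> : (fun x : R => - 2^-1 * x ^+ 2) = (- 2^-1) \*: (id ^+ 2) :> (R -> R).
    by apply/funext => y /=; rewrite !fctE.
  apply: is_derive_eq.
  by rewrite /GRing.scale /= expr1 mulr1; field.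
apply: is_derive_eq.
by rewrite /GRing.scale /= !mulrA mulrC mulrA.
Qed.

Lemma continuous_gauss : continuous gauss.
Proof. exact: (is_derive_continuous is_derive_gauss). Qed.

Lemma measurable_gauss : measurable_fun setT gauss.
Proof. exact: continuous_measurable_fun continuous_gauss. Qed.

Lemma integrable_gauss : mu.-integrable setT (EFin \o gauss).
Proof. exact: integrable_normal_pdf. Qed.

Lemma integrable_le f h : measurable_fun setT f -> (forall x, `|f x| <= h x) ->
  mu.-integrable setT (EFin \o h) -> mu.-integrable setT (EFin \o f).
Proof.
move=> mf fh; apply: le_integrable => //; first exact/measurable_EFinP.
by move=> x _; rewrite lee_fin (le_trans (fh x)) ?ler_norm.
Qed.

Lemma integrable_id_gauss : mu.-integrable setT (EFin \o (fun x => x * gauss x)).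
Proof.
(* Variance 2 halves the exponent of the density; the spare factor [expR (- x ^+ 2 / 4)] absorbs
   [|x|], since [|x| <= 1 + x ^+ 2 / 4]. *)
pose s : R := Num.sqrt 2.
have s0 : s != 0 by rewrite gt_eqF// sqrtr_gt0.
pose k : R := normal_peak 1 / normal_peak s.
have ki : mu.-integrable setT (EFin \o (fun x => k * normal_pdf 0 s x)).
  have -> : EFin \o (fun x => k * normal_pdf 0 s x) =
      (fun x => k%:E * (normal_pdf 0 s x)%:E)%E by [].
  by apply: integrableZl => //; exact: integrable_normal_pdf.
apply: integrable_le ki.
  by apply: measurable_funM => //; exact: measurable_gauss.
move=> x; rewrite normrM (gtr0_norm (gauss_gt0 x)) gaussE normal_pdfE// /normal_fun.
rewrite /k [leRHS]mulrA divfK; last by rewrite gt_eqF// normal_peak_gt0.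
rewrite mulrCA ler_wpM2l ?normal_peak_ge0//.
have -> : s ^+ 2 *+ 2 = 4 by rewrite /s sqr_sqrtr// -mulr_natr; lra.
rewrite subr0; set t := x ^+ 2 / 4.
have -> : - x ^+ 2 / 2 = - t + - t by rewrite /t; field.
have -> : - x ^+ 2 / 4 = - t by rewrite /t mulNr.
rewrite expRD mulrA ler_piMl ?expR_ge0//.
rewrite expRN ler_pdivrMr ?expR_gt0// mul1r.
apply: le_trans (expR_ge1Dx _).
have : t = (`|x| / 2) ^+ 2 by rewrite expr_div_n real_normK ?num_real// /t; field.
move: (`|x|) => y ->; have := sqr_ge0 (y / 2 - 1); nra.
Qed.

Lemma lipschitz1P h : 1.-lipschitz h -> forall x y, `|h x - h y| <= `|x - y|.
Proof. by move=> hL x y; have /= := hL (x, y) (conj I I); rewrite mul1r. Qed.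

Lemma lipschitz_continuous h : (forall x y, `|h x - h y| <= `|x - y|) ->
  continuous h.
Proof.
move=> hL x; apply/cvgrPdist_lt => e e0; near=> y.
apply: le_lt_trans (hL _ _) _; near: y.
exact: (@cvgr_dist_lt _ _ _ (nbhs x) _ id x).
Unshelve. all: by end_near. Qed.

Lemma integrable_lipschitz_gauss h c : (forall x y, `|h x - h y| <= `|x - y|) ->
  mu.-integrable setT (EFin \o (fun x => (h x - c) * gauss x)).
Proof.
move=> hL.
have mh : measurable_fun setT h.
  by apply: continuous_measurable_fun; exact: lipschitz_continuous.
pose k : R := `|h 0| + `|c|.
have ik : mu.-integrable setT
    (EFin \o (fun x => k * gauss x + `|x * gauss x|)).
  have -> : EFin \o (fun x => k * gauss x + `|x * gauss x|) =
      (fun x => (k%:E * (gauss x)%:E + `|(x * gauss x)%:E|)%E).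
    by apply/funext => x.
  apply: integrableD => //.
    by apply: integrableZl => //; exact: integrable_gauss.
  by apply: integrable_abse => //; exact: integrable_id_gauss.
apply: integrable_le ik => [|x].
  by apply: measurable_funM; [exact: measurable_funB|exact: measurable_gauss].
rewrite !normrM (gtr0_norm (gauss_gt0 x)) -mulrDl ler_wpM2r ?(ltW (gauss_gt0 _))//.
apply: le_trans (ler_normB _ _) _; rewrite /k -addrA (addrC `|c|) addrA lerD2r.
have := hL x 0; rewrite subr0 => /(le_trans (lerB_dist _ _)); lra.
Qed.

Definition lowint f x : R := \int[mu]_(t in `]-oo, x]) f t.

Lemma is_derive_lowint f x : continuous f -> mu.-integrable setT (EFin \o f) ->
  is_derive x 1 (lowint f) (f x).
Proof.
move=> cf intf.
have [df dfE] : derivable (lowint f) x 1 /\ derive1 (lowint f) x = f x.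
  apply: (@continuous_FTC1 R f -oo%O x (x + 1)).
  - by rewrite ltrDl.
  - by apply: integrableS intf.
  - exact: ltNyr.
  - exact: cf.
by apply: DeriveDef; [exact: df|rewrite -derive1E; exact: dfE].
Qed.

Lemma lowint_split f x : mu.-integrable setT (EFin \o f) ->
  \int[mu]_t f t = lowint f x + \int[mu]_(t in `]x, +oo[) f t.
Proof.
move=> intf; rewrite -Rintegral_setU//.
- by rewrite itv_setU_setT.
- by apply: integrableS intf => //; exact: measurableU.
- exact: disjoint_rays.
Qed.

Lemma cvg_lowint f : mu.-integrable setT (EFin \o f) ->
  lowint f n%:R @[n --> \oo] --> \int[mu]_t f t /\
  lowint f (- n%:R) @[n --> \oo] --> 0.
Proof.
move=> intf; have mf : measurable_fun setT f.
  by move/integrableP : intf => [/measurable_EFinP].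
have H (u : nat -> R) (g : R -> R) : measurable_fun setT g ->
    (forall t, (f \_ `]-oo, u n]) t @[n --> \oo] --> g t) ->
    lowint f (u n) @[n --> \oo] --> \int[mu]_t g t.
  move=> mg cg.
  have mfu n : measurable_fun setT (f \_ `]-oo, u n]).
    by apply/(measurable_restrictT _ _).1 => //; exact: measurable_funS mf.
  have [|||||ig _ c] := @dominated_convergence _ _ R mu setT measurableT
    (fun n => EFin \o (f \_ `]-oo, u n])) (EFin \o g) (fun t => `|(f t)%:E|)%E.
  - by move=> n; apply/measurable_EFinP; exact: mfu.
  - exact/measurable_EFinP.
  - by apply: aeW => t _; apply: cvg_EFin; [exact: nearW|exact: cg].
  - exact: integrable_abse.
  - apply: aeW => t n _ /=; rewrite lee_fin patchE.
    by case: ifP => // _; rewrite normr0.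
  have fin_g : (\int[mu]_t (g t)%:E)%E \is a fin_num by exact: integrable_fin_num.
  have := fine_cvg (_ : (\int[mu]_t ((f \_ `]-oo, u n]) t)%:E)%E @[n --> \oo] -->
     (fine (\int[mu]_t (g t)%:E))%:E).
  rewrite fineK// => /(_ _ c); apply: cvg_trans; apply: near_eq_cvg.
  by apply: nearW => n; rewrite /lowint Rintegral_mkcond.
split.
  apply: H => // t; apply: cvg_near_cst; near=> n.
  rewrite patchE mem_set//= in_itv/=; near: n.
  exact: nbhs_infty_ger.
have -> : 0 = \int[mu]_t (cst 0 t : R) by rewrite Rintegral_cst// mul0r.
apply: H => // t; apply: cvg_near_cst; near=> n.
rewrite patchE memNset//= in_itv/=; apply/negP; rewrite -ltNge ltrNl; near: n.
exact: nbhs_infty_gtr.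
Unshelve. all: by end_near. Qed.

Lemma cvg_gauss_nat : gauss n%:R @[n --> \oo] --> 0.
Proof.
have k0 := @normal_peak_ge0 R 1.
apply: (@squeeze_cvgr _ _ _ _ (cst 0) (fun n => normal_peak 1 * 2 * harmonic n)).
- near=> n; rewrite ltW ?gauss_gt0//= gaussE -mulrA ler_wpM2l// /harmonic/=.
  rewrite mulNr expRN ler_pdivlMr// mulrC ler_pdivrMr ?expR_gt0//.
  have := @expR_ge1Dx R (n%:R ^+ 2 / 2).
  have := sqr_ge0 (n%:R - 1 : R); rewrite -[n.+1%:R]natr1.
  move: (expR _) => e; nra.
- exact: cvg_cst.
- rewrite -[X in _ --> X](mulr0 (normal_peak 1 * 2)).
  by apply: cvgM; [exact: cvg_cst|exact: cvg_harmonic].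
Unshelve. all: by end_near. Qed.

Lemma gaussN x : gauss (- x) = gauss x.
Proof. by rewrite !gaussE sqrrN. Qed.

(** Both sides have the same derivative and vanish at minus infinity; the limit is taken along the
    negative integers. *)
Lemma lowint_id_gauss x : lowint (fun t => t * gauss t) x = - gauss x.
Proof.
have ii := integrable_id_gauss.
have ci : continuous (fun t : R => t * gauss t : R).
  by move=> t; apply: cvgM; [exact: cvg_id|exact: continuous_gauss].
pose F := (lowint (fun t => t * gauss t) + gauss : R -> R).
have dF y : is_derive y 1 F 0.
  have d1 := is_derive_lowint y ci ii; have d2 := is_derive_gauss y.
  by apply: is_derive_eq; rewrite mulNr subrr.
have Fc y : F y = F x.
  apply: is_derive_0_is_cst => ?; exact: dF.
have : F (- n%:R) @[n --> \oo] --> (0 + 0 : R).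
  rewrite /F !fctE; apply: cvgD; first exact: (cvg_lowint ii).2.
  by under eq_cvg do rewrite gaussN; exact: cvg_gauss_nat.
rewrite addr0 (_ : (fun n => _) = cst (F x)); last by apply/funext.
move=> /(cvg_unique _ (cvg_cst _)) => /(_ (@Rhausdorff R)).
by rewrite /F !fctE => /eqP; rewrite addr_eq0 => /eqP.
Qed.

Lemma integral_id_gauss : \int[mu]_t (t * gauss t) = 0.
Proof.
have := (cvg_lowint integrable_id_gauss).1.
rewrite (_ : (fun n => _) = (fun n => - gauss n%:R)); last first.
  by apply/funext => n; exact: lowint_id_gauss.
move=> /(cvg_unique (@Rhausdorff R)); apply.
by rewrite -oppr0; apply: cvgN; exact: cvg_gauss_nat.
Qed.

Lemma integral_gauss : \int[mu]_t gauss t = 1.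
Proof. by rewrite /Rintegral integral_normal_pdf. Qed.

Lemma upint_gauss x : \int[mu]_(t in `]x, +oo[) gauss t = 1 - lowint gauss x.
Proof. by rewrite -integral_gauss (lowint_split x integrable_gauss) addrC addKr. Qed.

Lemma lowint_gauss_ge0 x : 0 <= lowint gauss x.
Proof. by apply: Rintegral_ge0 => t _; exact/ltW/gauss_gt0. Qed.

Lemma lowint_gauss_le1 x : lowint gauss x <= 1.
Proof.
rewrite -subr_ge0 -upint_gauss.
by apply: Rintegral_ge0 => t _; exact/ltW/gauss_gt0.
Qed.

(* The derivative in [b] of either side is [(b - x) ^+ 2 * gauss b]. *)
Lemma mills_increment x a b : a <= b ->
  (1 + x ^+ 2) * lowint gauss a - (a - 2 * x) * gauss a <=
  (1 + x ^+ 2) * lowint gauss b - (b - 2 * x) * gauss b.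
Proof.
move=> ab.
pose K := (cst (1 + x ^+ 2) * lowint gauss - (id - cst (2 * x)) * gauss : R -> R).
have dK y : is_derive y 1 K ((y - x) ^+ 2 * gauss y).
  have d1 := is_derive_lowint y continuous_gauss integrable_gauss.
  have d2 := is_derive_gauss y.
  by apply: is_derive_eq; rewrite /GRing.scale/= !fctE; ring.
have : K a <= K b.
  by apply: is_derive_ndecr dK _ => // y _; rewrite mulr_ge0 ?sqr_ge0// ltW// gauss_gt0.
by rewrite /K !fctE.
Qed.

(** The increment is taken from [x] to [2 * x], where the boundary term [(b - 2 * x) * gauss b]
    vanishes, so no limit at infinity is involved. The lower bound mirrors this. *)
Lemma mills_upper x : 0 <= x ->
  x * gauss x <= (1 + x ^+ 2) * (1 - lowint gauss x).
Proof.
move=> x0; have xx : x <= 2 * x by lra.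
have := mills_increment x xx.
have : (1 + x ^+ 2) * (1 - lowint gauss (2 * x)) >= 0.
  by rewrite mulr_ge0 ?subr_ge0 ?lowint_gauss_le1// addr_ge0 ?sqr_ge0.
nra.
Qed.

Lemma mills_lower x : x <= 0 ->
  - (x * gauss x) <= (1 + x ^+ 2) * lowint gauss x.
Proof.
move=> x0; have xx : 2 * x <= x by lra.
have := mills_increment x xx.
have : (1 + x ^+ 2) * lowint gauss (2 * x) >= 0.
  by rewrite mulr_ge0 ?addr_ge0 ?sqr_ge0// lowint_gauss_ge0.
nra.
Qed.

Lemma le_Rintegral_gauss f1 f2 (D : set R) : measurable D ->
  mu.-integrable setT (EFin \o (fun t => f1 t * gauss t)) ->
  mu.-integrable setT (EFin \o (fun t => f2 t * gauss t)) ->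
  (forall t, D t -> f1 t <= f2 t) ->
  \int[mu]_(t in D) (f1 t * gauss t) <= \int[mu]_(t in D) (f2 t * gauss t).
Proof.
move=> mD i1 i2 f12; apply: le_Rintegral => //.
- exact: integrableS i1.
- exact: integrableS i2.
- by move=> t Dt; rewrite ler_wpM2r ?f12// ltW// gauss_gt0.
Qed.

(* A centred nondecreasing function is the extremal case: the left-hand sides
   below are [psi] and [psi + x * psi'] up to the factor [gauss x]. *)
Lemma stein_ndecr (H : R -> R) x :
  mu.-integrable setT (EFin \o (fun t => H t * gauss t)) ->
  \int[mu]_t (H t * gauss t) = 0 ->
  {homo H : s t / s <= t} ->
  let Psi := lowint (fun t => H t * gauss t) x in
  Psi <= 0 /\ (1 + x ^+ 2) * Psi + x * H x * gauss x <= 0.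
Proof.
move=> intH H0 ndH Psi.
have ic c : mu.-integrable setT (EFin \o (fun t => c * gauss t)).
  have -> : EFin \o (fun t => c * gauss t) = (fun t => c%:E * (gauss t)%:E)%E by [].
  by apply: integrableZl => //; exact: integrable_gauss.
have ig (D : set R) : measurable D -> mu.-integrable D (EFin \o gauss).
  by move=> mD; exact: integrableS integrable_gauss.
have lo : Psi <= H x * lowint gauss x.
  rewrite -RintegralZl//; last exact: ig.
  by apply: le_Rintegral_gauss => // t /=; rewrite in_itv/= => tx; exact: ndH.
(* Since [H] is centred, the integral below [x] is minus the integral above [x], where [H] is at
   least [H x]. *)
have up : Psi <= - H x * (1 - lowint gauss x).
  have := lowint_split x intH.
  rewrite H0 -/Psi => /eqP; rewrite eq_sym addr_eq0 => /eqP ->.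
  rewrite -upint_gauss mulNr lerN2 -RintegralZl//; last exact: ig.
  apply: le_Rintegral_gauss => // t /=; rewrite in_itv/= andbT => /ltW; exact: ndH.
have L0 := lowint_gauss_ge0 x; have L1 := lowint_gauss_le1 x.
have Psi0 : Psi <= 0 by have [h|h] := leP (H x) 0; nra.
split => //.
have x1 : 0 < 1 + x ^+ 2 by rewrite ltr_pwDl ?sqr_ge0.
have g0 := gauss_gt0 x.
(* The Mills bounds matter only when [x] and [H x] have the same sign; otherwise both summands are
   nonpositive. *)
have [x0|/ltW x0] := leP 0 x.
  have M := mills_upper x0.
  have [h|/ltW h] := leP (H x) 0.
    have : x * H x * gauss x <= 0.
      by rewrite mulr_le0_ge0 ?mulr_ge0_le0// ltW.
    nra.
  have : (1 + x ^+ 2) * Psi <= - H x * ((1 + x ^+ 2) * (1 - lowint gauss x)).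
    by rewrite mulrCA ler_wpM2l// ltW.
  nra.
have M := mills_lower x0.
have [h|/ltW h] := leP (H x) 0; last first.
  have : x * H x * gauss x <= 0.
    by rewrite mulr_le0_ge0 ?mulr_le0_ge0// ltW.
  nra.
have : (1 + x ^+ 2) * Psi <= H x * ((1 + x ^+ 2) * lowint gauss x).
  by rewrite mulrCA ler_wpM2l// ltW.
nra.
Qed.

End SteinEquation.

(** * Regularity of the Stein solution for a Lipschitz test function *)

Section SteinSolution.
Context {R : realType}.
Notation mu := (@lebesgue_measure R).
Implicit Types (x y b : R) (f h F : R -> R).

Lemma lipschitz_derive F dF (k : R) : (forall x, is_derive x 1 F (dF x)) ->
  (forall x, `|dF x| <= k) -> forall x y, `|F x - F y| <= k * `|x - y|.
Proof.
move=> dFx dFk; have W x y : x <= y -> `|F x - F y| <= k * `|x - y|.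
  move=> xy.
  have cF : {within `[x, y], continuous F}.
    by apply: derivable_within_continuous => z _; have [] := dFx z.
  have [z _ e] := MVT_segment xy (fun z _ => dFx z) cF.
  by rewrite distrC e normrM (distrC x y) ler_wpM2r.
move=> x y; have [xy|/ltW yx] := leP x y; first exact: W.
by rewrite distrC (distrC x y); exact: W.
Qed.

(** The solution is the integral of the centred, Gauss-weighted [h] up to [x], divided by [gauss x].
    The functions [t + (h t - c)] and [t - (h t - c)] are nondecreasing and centred, which bounds
    [psi] and [psi + x * dpsi] by 1; the bounds on [dpsi] follow from these two. *)
Lemma stein_solution h : (forall x y, `|h x - h y| <= `|x - y|) ->
  let c := \int[mu]_t (h t * gauss t) in
  exists psi dpsi : R -> R, [/\
    forall x, is_derive x 1 psi (dpsi x),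
    forall x, dpsi x - x * psi x = h x - c,
    forall x, `|dpsi x| <= 4 &
    forall x y, `|dpsi x - dpsi y| <= 2 * `|x - y|].
Proof.
move=> hL c.
have ch : continuous h by exact: lipschitz_continuous.
pose k t := (h t - c) * gauss t.
have ik : mu.-integrable setT (EFin \o k) by exact: integrable_lipschitz_gauss.
have k0 : \int[mu]_t k t = 0.
  have -> : k = (fun t => h t * gauss t - c * gauss t).
    by apply/funext => t; rewrite /k mulrBl.
  rewrite RintegralB//.
  - by rewrite RintegralZl// ?integral_gauss ?mulr1 ?subrr//; exact: integrable_gauss.
  - have := integrable_lipschitz_gauss 0 hL.
    by under [X in EFin \o X]eq_fun do rewrite subr0.
  - have -> : EFin \o (fun t => c * gauss t) = (fun t => c%:E * (gauss t)%:E)%E by [].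
    by apply: integrableZl => //; exact: integrable_gauss.
have ck : continuous k.
  move=> t; apply: cvgM; last exact: continuous_gauss.
  by apply: cvgB; [exact: ch|exact: cvg_cst].
pose Psi := lowint k.
pose psi x := Psi x / gauss x.
pose dpsi x := x * psi x + (h x - c).
have g0 x : gauss x != 0 by rewrite gt_eqF// gauss_gt0.
have dpsiP x : is_derive x 1 psi (dpsi x).
  have d1 := is_derive_lowint x ck ik; have d2 := is_derive_gauss x.
  have d3 : is_derive x 1 (fun y => (gauss y)^-1) (- (gauss x)^-2 *: (- x * gauss x)).
    exact: is_deriveV.
  have -> : psi = Psi * (fun y => (gauss y)^-1) by [].
  apply: is_derive_eq; rewrite /GRing.scale/= /dpsi /psi /k /Psi.
  by have := g0 x; move: (gauss x) (lowint k x) => g L gn; field.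
(* The summand [t] of [H] contributes [- gauss x] to both conclusions of [stein_ndecr]; moved to the
   other side, it is the bound claimed here. *)
have key (s : R) x : s = 1 \/ s = -1 ->
    s * Psi x <= gauss x /\ s * ((1 + x ^+ 2) * Psi x + x * (h x - c) * gauss x) <= gauss x.
  move=> s1; pose H t := t + s * (h t - c).
  have ss (t : R) : `|s * t| = `|t|.
    by case: s1 => ->; rewrite ?mul1r ?mulN1r ?normrN.
  have HE : (fun t => H t * gauss t) = (fun t => t * gauss t + s * k t).
    by apply/funext => t; rewrite /H /k mulrDl mulrA.
  have isk : mu.-integrable setT (EFin \o (fun t => s * k t)).
    have -> : EFin \o (fun t => s * k t) = (fun t => s%:E * (k t)%:E)%E by [].
    exact: integrableZl.
  have iH : mu.-integrable setT (EFin \o (fun t => H t * gauss t)).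
    rewrite HE.
    have -> : EFin \o (fun t => t * gauss t + s * k t) =
      (fun t => (t * gauss t)%:E + (s * k t)%:E)%E by [].
    by apply: integrableD => //; exact: integrable_id_gauss.
  have [||] := @stein_ndecr _ H x iH.
  - by rewrite HE RintegralD ?integral_id_gauss ?add0r ?RintegralZl ?k0 ?mulr0//;
      exact: integrable_id_gauss.
  - move=> u v uv; rewrite /H -subr_ge0.
    have := hL u v; rewrite -ss => /ler_normlP[+ +].
    have := distrC u v => ->; rewrite (ger0_norm (_ : 0 <= v - u)) ?subr_ge0//.
    lra.
  have -> : lowint (fun t => H t * gauss t) x = - gauss x + s * Psi x.
    rewrite -lowint_id_gauss HE /lowint RintegralD//.
    - by rewrite RintegralZl//; exact: integrableS ik.
    - by apply: integrableS integrable_id_gauss.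
    - exact: integrableS isk.
  rewrite /H; nra.
have psi1 x : `|psi x| <= 1.
  have [] := key 1 x (or_introl erefl); have [] := key (-1) x (or_intror erefl).
  rewrite ler_norml /psi ler_pdivlMr ?ler_pdivrMr ?gauss_gt0//; lra.
have dpsi1 x : `|psi x + x * dpsi x| <= 1.
  have [_] := key 1 x (or_introl erefl); have [_] := key (-1) x (or_intror erefl).
  have -> : psi x + x * dpsi x =
      ((1 + x ^+ 2) * Psi x + x * (h x - c) * gauss x) / gauss x.
    by rewrite /dpsi /psi; have := g0 x; move: (gauss x) => g gn; field.
  rewrite ler_norml ler_pdivlMr ?ler_pdivrMr ?gauss_gt0//; lra.
(* By the Stein equation [dpsi] is, up to a constant, [x * psi x + h x]; the first summand has
   derivative [psi + x * dpsi], so each of the two is 1-Lipschitz. *)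
have dL x y : `|dpsi x - dpsi y| <= 2 * `|x - y|.
  have := @lipschitz_derive (fun x => x * psi x) (fun x => psi x + x * dpsi x) 1 _ dpsi1 x y.
  rewrite mul1r => /(_ _)/wrap[|D].
    move=> z; have d1 := dpsiP z.
    have -> : (fun x => x * psi x) = id * psi by [].
    by apply: is_derive_eq; rewrite /GRing.scale/= mulr1 addrC.
  rewrite /dpsi; have := hL x y.
  have -> : x * psi x + (h x - c) - (y * psi y + (h y - c)) =
    (x * psi x - y * psi y) + (h x - h y) by ring.
  move=> E; apply: le_trans (ler_normD _ _) _; lra.
exists psi, dpsi; split => //.
  by move=> x; rewrite /dpsi addrC addKr.
(* Away from the origin, [x * dpsi x] is bounded by 2. A point of the unit interval around 0 lies
   within distance 1 of 1 or -1, which costs another 2. *)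
have far x : 1 <= `|x| -> `|dpsi x| <= 2.
  move=> x1; have : `|x * dpsi x| <= 2.
    rewrite (_ : x * dpsi x = (psi x + x * dpsi x) - psi x); last by ring.
    apply: le_trans (ler_normB _ _) _; have := psi1 x; have := dpsi1 x; lra.
  rewrite normrM; apply: le_trans; rewrite ler_peMl//.
move=> x; have [x1|x1] := leP 1 `|x|; first by have := far _ x1; lra.
have : `|dpsi x - dpsi (if 0 <= x then 1 else -1)| <= 2.
  apply: le_trans (dL _ _) _; rewrite -[leRHS]mulr1 ler_pM2l//.
  move: x1; rewrite ltr_norml => /andP[]; case: ifPn => x0 *.
    by rewrite ler_norml; lra.
  by move: x0; rewrite -ltNge ler_norml; lra.
have : `|dpsi (if 0 <= x then 1 else -1)| <= 2.
  by apply: far; case: ifP; rewrite ?normrN normr1.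
move: (dpsi (if _ then _ else _)) => u u2 xu2.
rewrite -(subrK u (dpsi x)); apply: le_trans (ler_normD _ _) _; lra.
Qed.

Lemma taylor_lipschitz_derive (psi dpsi : R -> R) :
  (forall x, is_derive x 1 psi (dpsi x)) ->
  (forall x y, `|dpsi x - dpsi y| <= 2 * `|x - y|) ->
  forall x y, `|psi y - psi x - dpsi x * (y - x)| <= (y - x) ^+ 2.
Proof.
move=> dpsiP dL x.
(* The sign [s] selects the side of the absolute value and [e] the side of [x] on which [y] lies;
   monotonicity of [K] then covers the four cases. A second derivative of [psi] is never formed. *)
have W (s e : R) y : `|s| = 1 -> e = 1 \/ e = -1 -> 0 <= e * (y - x) ->
    s * (psi y - psi x - dpsi x * (y - x)) <= (y - x) ^+ 2.
  move=> s1 e1 exy.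
  pose K : R -> R := (cst e * ((id - cst x) * (id - cst x) -
    cst s * (psi - cst (psi x) - cst (dpsi x) * (id - cst x)))).
  have dK (z : R) : is_derive z 1 K (e * (2 * (z - x) - s * (dpsi z - dpsi x))).
    have d1 := dpsiP z.
    by apply: is_derive_eq; rewrite /GRing.scale/= !fctE; ring.
  have K0 : K x = 0 by rewrite /K !fctE; ring.
  have dK0 (z : R) : 0 <= e * (z - x) -> 0 <= e * (2 * (z - x) - s * (dpsi z - dpsi x)).
    move=> ez; rewrite mulrBr subr_ge0 (le_trans (ler_norm _))// !normrM s1 mul1r.
    have e1' : `|e| = 1 by case: e1 => ->; rewrite ?normrN normr1.
    rewrite e1' mul1r (le_trans (dL _ _))// mulrCA ler_pM2l//.
    by rewrite -[leRHS]ger0_norm// normrM e1' mul1r.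
  case: e1 => ee; subst e.
    have xy : x <= y by rewrite -subr_ge0 -(mul1r (y - x)).
    have := is_derive_ndecr xy dK; rewrite K0 /K !fctE => /(_ _)/wrap[z /andP[xz _]|].
      by apply: dK0; rewrite mul1r subr_ge0.
    by rewrite mul1r expr2 subr_ge0.
  have xy : y <= x by rewrite -subr_ge0 -opprB -mulN1r.
  have := is_derive_ndecr xy dK; rewrite K0 /K !fctE => /(_ _)/wrap[z /andP[_ xz]|].
    by apply: dK0; rewrite mulN1r opprB subr_ge0.
  by rewrite mulN1r oppr_le0 expr2 subr_ge0.
move=> y; have [e [e1 e0]] : exists e : R, (e = 1 \/ e = -1) /\ 0 <= e * (y - x).
  have [xy|/ltW xy] := leP x y.
    by exists 1; split; [left|rewrite mul1r subr_ge0].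
  by exists (-1); split; [right|rewrite mulN1r opprB subr_ge0].
rewrite ler_norml lerNl; apply/andP; split.
  by rewrite -mulN1r; apply: W e1 e0; rewrite normrN normr1.
by rewrite -[leLHS]mul1r; apply: W e1 e0; rewrite normr1.
Qed.

Local Open Scope ereal_scope.

(** The Radon-Nikodym derivative of the normal law and [gauss] have the same integral over every
    measurable set, hence agree almost everywhere. *)
Lemma ge0_integral_normal_prob (f : R -> \bar R) : measurable_fun setT f ->
  (forall x, 0 <= f x) ->
  \int[normal_prob 0 1]_x f x = \int[mu]_x (f x * (gauss x)%:E).
Proof.
move=> mf f0.
have dom := @normal_prob_dominates R 0 1.
rewrite -(Radon_Nikodym_SigmaFinite.change_of_variables dom)//.
have irn := Radon_Nikodym_SigmaFinite.f_integrable dom.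
have mg : measurable_fun setT (EFin \o @gauss R).
  by apply/measurable_EFinP; exact: measurable_gauss.
apply: ae_eq_integral => //.
- by apply: emeasurable_funM => //; exact: measurable_int irn.
- exact: emeasurable_funM.
- apply: ae_eqe_mul2l; apply: integral_ae_eq => // E _ mE.
  by rewrite -Radon_Nikodym_SigmaFinite.f_integral.
Qed.

Lemma integral_normal_prob (h : R -> R) : measurable_fun setT h ->
  \int[normal_prob 0 1]_x (h x)%:E = \int[mu]_x (h x * gauss x)%:E.
Proof.
move=> mh; have mh' : measurable_fun setT (EFin \o h) by exact/measurable_EFinP.
rewrite integralE [RHS]integralE; congr (_ - _).
  rewrite ge0_integral_normal_prob//; last exact: measurable_funepos.
  apply: eq_integral => x _; rewrite !funeposE -!EFin_max -EFinM.
  by rewrite maxr_pMl ?mul0r// ltW// gauss_gt0.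
rewrite ge0_integral_normal_prob//; last exact: measurable_funeneg.
apply: eq_integral => x _; rewrite !funenegE -!EFinN -!EFin_max -EFinM.
by rewrite maxr_pMl ?mul0r ?mulNr// ltW// gauss_gt0.
Qed.

End SteinSolution.

(** * Square-integrable random variables *)

Section RealExpectation.
Context {d : measure_display} {S : measurableType d} {R : realType}.
Variable Q : probability S R.
Implicit Types (F G : S -> R).

(** An infinite or undefined expectation has the default value of [fine], hence the [integ] and [L2]
    hypotheses throughout. *)
Definition Ex F : R := \int[Q]_v F v.
Definition integ F := Q.-integrable setT (EFin \o F).
Definition L2 F := measurable_fun setT F /\ integ (fun v => F v ^+ 2).

Lemma eq_Ex F G : (forall v, F v = G v) -> Ex F = Ex G.
Proof. by move=> FG; congr Ex; apply/funext. Qed.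

Lemma eq_integ F G : (forall v, F v = G v) -> integ F = integ G.
Proof. by move=> FG; congr integ; apply/funext. Qed.

Lemma eq_L2 F G : (forall v, F v = G v) -> L2 F = L2 G.
Proof. by move=> FG; congr L2; apply/funext. Qed.

Lemma integ_mfun F : integ F -> measurable_fun setT F.
Proof. by move=> /integrableP[/measurable_EFinP]. Qed.

Lemma integ_le F G : measurable_fun setT F -> (forall v, `|F v| <= G v) ->
  integ G -> integ F.
Proof.
move=> mF FG; apply: le_integrable => //; first exact/measurable_EFinP.
by move=> v _; rewrite lee_fin (le_trans (FG v)) ?ler_norm.
Qed.

Lemma integ_cst c : integ (cst c).
Proof. exact: finite_measure_integrable_cst. Qed.

Lemma integ_bounded F c : measurable_fun setT F -> (forall v, `|F v| <= c) ->
  integ F.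
Proof. by move=> mF Fc; apply: (integ_le mF Fc); exact: integ_cst. Qed.

Lemma integD F G : integ F -> integ G -> integ (fun v => F v + G v).
Proof. by move=> iF iG; rewrite /integ; exact: (integrableD _ iF iG). Qed.

Lemma integZ c F : integ F -> integ (fun v => c * F v).
Proof. by move=> iF; rewrite /integ; exact: (integrableZl measurableT c iF). Qed.

Lemma integB F G : integ F -> integ G -> integ (fun v => F v - G v).
Proof. by move=> iF iG; rewrite /integ; exact: (integrableB _ iF iG). Qed.

Lemma integ_norm F : integ F -> integ (fun v => `|F v|).
Proof. by move=> iF; rewrite /integ; exact: (integrable_abse iF). Qed.

Lemma integ_sum (I : Type) (r : seq I) (P : pred I) (F : I -> S -> R) :
  (forall i, P i -> integ (F i)) -> integ (fun v => \sum_(i <- r | P i) F i v).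
Proof.
move=> iF; elim: r => [|i r IH].
  rewrite (_ : (fun v => _) = cst 0); first exact: integ_cst.
  by apply/funext => v; rewrite big_nil.
rewrite (_ : (fun v => _) = (fun v => (if P i then F i v else 0) +
    \sum_(i <- r | P i) F i v)); last first.
  by apply/funext => v; rewrite big_cons; case: ifP => // _; rewrite add0r.
by apply: integD => //; case Pi: (P i); [exact: iF|exact: (integ_cst 0)].
Qed.

Lemma ExD F G : integ F -> integ G -> Ex (fun v => F v + G v) = Ex F + Ex G.
Proof. by move=> iF iG; rewrite /Ex RintegralD. Qed.

Lemma ExB F G : integ F -> integ G -> Ex (fun v => F v - G v) = Ex F - Ex G.
Proof. by move=> iF iG; rewrite /Ex RintegralB. Qed.

Lemma ExZ c F : integ F -> Ex (fun v => c * F v) = c * Ex F.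
Proof. by move=> iF; rewrite /Ex RintegralZl. Qed.

Lemma ExN F : integ F -> Ex (fun v => - F v) = - Ex F.
Proof.
move=> iF; rewrite -mulN1r -ExZ//; congr Ex; apply/funext => v; by rewrite mulN1r.
Qed.

Lemma Ex_cst c : Ex (cst c) = c.
Proof. by rewrite /Ex Rintegral_cst// [X in fine X](@probability_setT _ _ _ Q) mulr1. Qed.

Lemma Ex_sum (I : Type) (r : seq I) (P : pred I) (F : I -> S -> R) :
  (forall i, P i -> integ (F i)) ->
  Ex (fun v => \sum_(i <- r | P i) F i v) = \sum_(i <- r | P i) Ex (F i).
Proof.
move=> iF; elim: r => [|i r IH].
  rewrite big_nil -[RHS](Ex_cst 0); congr Ex.
  by apply/funext => v; rewrite big_nil.
rewrite big_cons -IH; case: ifPn => Pi.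
  rewrite -ExD//; [|exact: iF|exact: integ_sum].
  by congr Ex; apply/funext => v; rewrite big_cons Pi.
by congr Ex; apply/funext => v; rewrite big_cons (negbTE Pi).
Qed.

Lemma Ex_ge0 F : (forall v, 0 <= F v) -> 0 <= Ex F.
Proof. by move=> F0; exact: Rintegral_ge0. Qed.

Lemma Ex_le F G : integ F -> integ G -> (forall v, F v <= G v) -> Ex F <= Ex G.
Proof. by move=> iF iG FG; exact: le_Rintegral. Qed.

Lemma Ex_norm F : integ F -> `|Ex F| <= Ex (fun v => `|F v|).
Proof. by move=> iF; exact: le_normr_Rintegral. Qed.

Lemma L2_mul F G : L2 F -> L2 G -> integ (fun v => F v * G v).
Proof.
move=> [mF iF] [mG iG]; apply: (@integ_le _ (fun v => F v ^+ 2 + G v ^+ 2)).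
- exact: measurable_funM.
- move=> v; rewrite ler_norml.
  have := sqr_ge0 (F v - G v); have := sqr_ge0 (F v + G v).
  have := sqr_ge0 (F v); have := sqr_ge0 (G v); nra.
- exact: integD.
Qed.

Lemma L2_le F G : measurable_fun setT F -> (forall v, `|F v| <= `|G v|) ->
  L2 G -> L2 F.
Proof.
move=> mF FG [mG iG]; split=> //; apply: integ_le iG.
  exact: measurable_funX.
move=> v; rewrite normrX -[leRHS]real_normK ?num_real// lerXn2r ?nnegrE//.
Qed.

Lemma L2_cst c : L2 (cst c).
Proof. by split => //; exact: (integ_cst (c ^+ 2)). Qed.

Lemma L2_integ F : L2 F -> integ F.
Proof.
move=> LF; rewrite (_ : F = fun v => F v * cst 1 v); last first.
  by apply/funext => v; rewrite mulr1.
by apply: L2_mul => //; exact: L2_cst.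
Qed.

Lemma L2D F G : L2 F -> L2 G -> L2 (fun v => F v + G v).
Proof.
move=> LF LG; split; first by apply: measurable_funD; [exact: LF.1|exact: LG.1].
rewrite (_ : (fun v => _) = fun v => F v ^+ 2 + (2 * (F v * G v) + G v ^+ 2)).
  by apply: integD; [exact: LF.2|apply: integD; [exact/integZ/L2_mul|exact: LG.2]].
by apply/funext => v; ring.
Qed.

Lemma L2Z c F : L2 F -> L2 (fun v => c * F v).
Proof.
move=> [mF iF]; split; first exact: measurable_funM.
rewrite (_ : (fun v => _) = fun v => c ^+ 2 * F v ^+ 2); first exact: integZ.
by apply/funext => v; rewrite exprMn.
Qed.

Lemma L2B F G : L2 F -> L2 G -> L2 (fun v => F v - G v).
Proof.
move=> LF LG; rewrite (_ : (fun v => _) = fun v => F v + -1 * G v).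
  by apply: L2D => //; exact: L2Z.
by apply/funext => v; rewrite mulN1r.
Qed.

Lemma L2_sum (I : Type) (r : seq I) (P : pred I) (F : I -> S -> R) :
  (forall i, P i -> L2 (F i)) -> L2 (fun v => \sum_(i <- r | P i) F i v).
Proof.
move=> iF; elim: r => [|i r IH].
  rewrite (_ : (fun v => _) = cst 0); first exact: L2_cst.
  by apply/funext => v; rewrite big_nil.
rewrite (_ : (fun v => _) = (fun v => (if P i then F i v else 0) +
    \sum_(i <- r | P i) F i v)); last first.
  by apply/funext => v; rewrite big_cons; case: ifP => // _; rewrite add0r.
by apply: L2D => //; case Pi: (P i); [exact: iF|exact: (L2_cst 0)].
Qed.

Lemma L2_bounded_mul F G c : measurable_fun setT F -> (forall v, `|F v| <= c) ->
  L2 G -> L2 (fun v => F v * G v).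
Proof.
move=> mF Fc LG; apply: L2_le (L2Z c LG).
  by apply: measurable_funM => //; exact: LG.1.
move=> v; rewrite !normrM ler_wpM2r//.
by rewrite (le_trans (Fc v))// ler_norm.
Qed.

(** The quadratic form [E (s F + t G)^2] is nonnegative; at [(- c, a)] it equals
    [a * (a * b - c ^+ 2)]. If [a = 0], the point [(b, - c)] gives [- b * c ^+ 2], and if [b = 0] as
    well, [(1, 1)] and [(1, -1)] force [c = 0]. *)
Lemma cauchy_schwarz F G : L2 F -> L2 G ->
  Ex (fun v => F v * G v) ^+ 2 <= Ex (fun v => F v ^+ 2) * Ex (fun v => G v ^+ 2).
Proof.
move=> LF LG; have iFG := L2_mul LF LG.
set a := Ex (fun v => F v ^+ 2); set b := Ex (fun v => G v ^+ 2).
set c := Ex _.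
have H (s t : R) : 0 <= s ^+ 2 * a + 2 * (s * t) * c + t ^+ 2 * b.
  have iF2 := LF.2; have iG2 := LG.2.
  rewrite -ExZ// -ExZ// -ExZ// -ExD; [|exact: integZ..].
  rewrite -ExD; [|by apply: integD; exact: integZ|exact: integZ].
  apply: Ex_ge0 => v.
  rewrite [leRHS](_ : _ = (s * F v + t * G v) ^+ 2) ?sqr_ge0//; ring.
have a0 : 0 <= a by apply: Ex_ge0 => v; exact: sqr_ge0.
have b0 : 0 <= b by apply: Ex_ge0 => v; exact: sqr_ge0.
have [a_eq0|an0] := eqVneq a 0.
  have [b_eq0|bn0] := eqVneq b 0.
    by have := H 1 1; have := H 1 (-1); rewrite a_eq0 b_eq0; nra.
  have := H b (- c); rewrite a_eq0.
  have bp : 0 < b by rewrite lt_def bn0.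
  nra.
have ap : 0 < a by rewrite lt_def an0.
have := H (- c) a; nra.
Qed.

End RealExpectation.

(** * Independent and identically distributed families *)

Section PathSpace.
Context {dT : measure_display} {T : measurableType dT}.
Implicit Types I J : choiceType.

Definition cylinder I (s : seq I) (A : I -> set T) : set (I -> T) :=
  [set v | forall i, i \in s -> A i (v i)].

Definition cylinders I : set (set (I -> T)) :=
  [set C | exists s A, (forall i, measurable (A i)) /\ C = cylinder s A].

(** The product sigma-algebra. Its generators are stable under intersection, so laws can be compared
    on cylinders alone. *)
Definition pathspace I := g_sigma_algebraType (@cylinders I).

Lemma measurable_cylinder I (s : seq I) (A : I -> set T) :
  (forall i, measurable (A i)) -> measurable (cylinder s A : set (pathspace I)).
Proof. by move=> mA; apply: sub_sigma_algebra; exists s, A. Qed.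

Lemma cylinders_setI I : setI_closed (@cylinders I).
Proof.
move=> _ _ [s1 [A1 [mA1 ->]]] [s2 [A2 [mA2 ->]]].
exists (s1 ++ s2), (fun i => (if i \in s1 then A1 i else setT) `&`
                             (if i \in s2 then A2 i else setT)); split.
  by move=> i; apply: measurableI; case: ifP.
apply/seteqP; split => v /=.
  move=> [v1 v2] i _; split; case: ifP => // ?; [exact: v1|exact: v2].
move=> v12; split => i si; have := v12 i; rewrite mem_cat si ?orbT => /(_ isT)[] //.
Qed.

(** A list and its [undup] define the same cylinder, so it suffices to test duplicate-free lists,
    for which independence gives a product formula. *)
Lemma path_measure_unique I (R : realType) (m1 : probability (pathspace I) R)
    (m2 : {measure set (pathspace I) -> \bar R}) :
  (forall s A, uniq s -> (forall i, measurable (A i)) ->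
     m1 (cylinder s A) = m2 (cylinder s A)) ->
  forall B, measurable B -> m1 B = m2 B.
Proof.
move=> m12 B mB; apply: (@measure_unique _ R (pathspace I) (@cylinders I) (fun=> setT)
  erefl) => //.
- exact: cylinders_setI.
- by move=> _; exists [::], (fun=> setT); split => //; apply/seteqP; split.
- by apply/seteqP; split => // v _; exists 0%N.
- move=> _ [s [A [mA ->]]]; have -> : cylinder s A = cylinder (undup s) A.
    by apply/seteqP; split => v /= vA i si; apply: vA; move: si; rewrite mem_undup.
  exact/m12/mA/undup_uniq.
- by move=> _; apply: (le_lt_trans (probability_le1 m1 measurableT)); exact: ltry.
Qed.

Lemma measurable_coord I (i : I) : measurable_fun setT (fun v : pathspace I => v i).
Proof.
move=> _ B mB; rewrite setTI.
rewrite (_ : _ @^-1` _ = cylinder [:: i] (fun=> B)); first exact: measurable_cylinder.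
apply/seteqP; split => v /=; first by move=> Bv j; rewrite inE => /eqP ->.
by apply; rewrite inE.
Qed.

Lemma measurable_fun_path d (S : measurableType d) I (f : S -> pathspace I) :
  (forall i, measurable_fun setT (fun x => f x i)) -> measurable_fun setT f.
Proof.
move=> mf; apply: (@measurability _ _ S (pathspace I) setT f (@cylinders I) erefl).
move=> _ [_ [s [A [mA ->]]] <-].
rewrite setTI (_ : _ @^-1` _ = \big[setI/setT]_(i <- s) ((fun x => f x i) @^-1` A i)).
  by apply: bigsetI_measurable => i _; rewrite -[X in measurable X]setTI; exact: mf.
rewrite -bigcap_seq; apply/seteqP; split => x /=; exact.
Qed.

(** Restriction to a block of indices and renaming of indices are both of this form. *)
Definition shift I J (e : J -> I) (v : pathspace I) : pathspace J := v \o e.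

Lemma measurable_shift I J (e : J -> I) : measurable_fun setT (@shift I J e).
Proof. by apply: measurable_fun_path => j; exact: measurable_coord. Qed.

Definition coords I n (e : 'I_n -> I) (v : pathspace I) : n.-tuple T :=
  [tuple v (e k) | k < n].

Lemma measurable_coords I n (e : 'I_n -> I) : measurable_fun setT (coords e).
Proof.
apply/measurable_fun_tnthP => k.
rewrite (_ : _ \o _ = fun v : pathspace I => v (e k)); first exact: measurable_coord.
by apply/funext => v /=; rewrite tnth_mktuple.
Qed.

End PathSpace.
Arguments pathspace {dT} T I.

HB.instance Definition _ dT (T : measurableType dT) (I J : choiceType) (e : J -> I) :=
  isMeasurableFun.Build _ _ _ _ (@shift dT T I J e) (measurable_shift e).

Section Law.
Context {R : realType} {dT : measure_display} {T : measurableType dT}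
  {d : measure_display} {Omega : measurableType d} (P : probability Omega R)
  (X : nat -> {RV P >-> T}).
Hypothesis iidX : iid X.
Local Open Scope ereal_scope.

Definition marginal (B : set T) : \bar R := P (X 0 @^-1` B).

Definition process (I : choiceType) (e : I -> nat) (w : Omega) : pathspace T I :=
  fun i => X (e i) w.

Lemma measurable_process (I : choiceType) (e : I -> nat) :
  measurable_fun setT (process e).
Proof. by apply: measurable_fun_path => i; exact: measurable_funP. Qed.

HB.instance Definition _ (I : choiceType) (e : I -> nat) :=
  isMeasurableFun.Build _ _ _ _ (process e) (measurable_process e).

Definition law (I : choiceType) (e : I -> nat) : probability (pathspace T I) R :=
  distribution P (process e).

Lemma law_cylinder (I : choiceType) (e : I -> nat) (s : seq I) (A : I -> set T) :
  injective e -> uniq s -> (forall i, measurable (A i)) ->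
  law e (cylinder s A) = \prod_(i <- s) marginal (A i).
Proof.
move=> ie us mA; case: s us => [|i0 s] us.
  rewrite big_nil (_ : cylinder _ _ = setT) ?probability_setT//.
  by apply/seteqP; split.
set s' := i0 :: s in us *.
(* Independence is stated for natural indices; [A'] transports [A] along [e], inverting [e] on the
   list. The default [i0] is the reason for treating the empty list apart. *)
pose A' k := A (nth i0 s' (index k (map e s'))).
have A'E i : i \in s' -> A' (e i) = A i.
  by move=> si; rewrite /A' index_map// nth_index.
have [ind same] := iidX.
have fE k : (k \in [fset k in map e s']%fset) = (k \in map e s') by rewrite in_fset.
have := ind [fset k in map e s']%fset A' (fun k => mA _).
rewrite (_ : \bigcap_(_ in _) _ = process e @^-1` cylinder s' A); last first.
  apply/seteqP; split => w /= H.
    by move=> i si; rewrite -A'E//; apply: H; rewrite /= fE map_f.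
  by move=> k /=; rewrite fE => /mapP[i si ->] /=; rewrite A'E//; exact: H.
move=> E; rewrite [LHS]E {E}.
rewrite (perm_big (map e s')); last first.
  apply: uniq_perm; [exact: fset_uniq|by rewrite map_inj_uniq|].
  exact: fE.
rewrite big_map; apply: eq_big_seq => i si; rewrite A'E//.
exact: same.
Qed.

(** Both laws are products of copies of [marginal]. All exchanges and resamplings below rest on this
    fact. *)
Lemma law_eq (I : choiceType) (e e' : I -> nat) : injective e -> injective e' ->
  forall B, measurable B -> law e B = law e' B.
Proof.
move=> ie ie'; apply: path_measure_unique => s A us mA.
rewrite (law_cylinder ie us mA); exact/esym/law_cylinder.
Qed.

End Law.

(** * Renaming of indices and independence of disjoint blocks *)

Section Exchangeability.
Local Open Scope ereal_scope.

Lemma integral_distribution_measurable (R : realType) d1 d2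
    (S1 : measurableType d1) (S2 : measurableType d2) (P : probability S1 R)
    (Y : {mfun S1 >-> S2}) (f : S2 -> \bar R) : measurable_fun setT f ->
  \int[distribution P Y]_y f y = \int[P]_x f (Y x).
Proof.
move=> mf; rewrite integralE [RHS]integralE; congr (_ - _).
  have mp := measurable_funepos mf.
  apply: eq_trans (ge0_integral_distribution _ mp (fun=> funepos_ge0 f _)) _.
  by rewrite -funepos_comp.
have mp := measurable_funeneg mf.
apply: eq_trans (ge0_integral_distribution _ mp (fun=> funeneg_ge0 f _)) _.
by rewrite -funeneg_comp.
Qed.

Context {R : realType} {dT : measure_display} {T : measurableType dT}
  {d : measure_display} {Omega : measurableType d} (P : probability Omega R)
  (X : nat -> {RV P >-> T}).
Hypothesis iidX : iid X.
Notation law := (@law R dT T d Omega P X).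

Lemma integral_law (I : choiceType) (e e' : I -> nat) (f : pathspace T I -> \bar R) :
  injective e -> injective e' -> \int[law e]_v f v = \int[law e']_v f v.
Proof.
move=> ie ie'; apply: eq_measure_integral => B mB _; exact: (law_eq iidX).
Qed.

Lemma integral_shift (I J : choiceType) (e : I -> nat) (e' : J -> nat)
    (r : J -> I) (f : pathspace T J -> \bar R) :
  injective e -> injective e' -> injective r -> measurable_fun setT f ->
  \int[law e]_v f (shift r v) = \int[law e']_v f v.
Proof.
move=> ie ie' ir mf.
rewrite (integral_law _ ie' (inj_comp ie ir)).
have mfr : measurable_fun setT (fun v => f (shift r v)).
  by apply: (measurableT_comp mf); exact: measurable_shift.
apply: (eq_trans (integral_distribution_measurable P (process X e) mfr)).
exact/esym/(integral_distribution_measurable P (process X (e \o r)) mf).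
Qed.

Section Blocks.
Variables (I J1 J2 : choiceType) (e : I -> nat) (r1 : J1 -> I) (r2 : J2 -> I)
  (e1 : J1 -> nat) (e2 : J2 -> nat).
Hypotheses (ie : injective e) (ir1 : injective r1) (ir2 : injective r2)
  (ie1 : injective e1) (ie2 : injective e2) (dr : forall i j, r1 i != r2 j).

Let r (k : J1 + J2) : I := match k with inl i => r1 i | inr j => r2 j end.

Let ir : injective r.
Proof.
move=> [i|i] [j|j] /=.
- by move=> /ir1 ->.
- by move=> /eqP; rewrite (negbTE (dr _ _)).
- by move=> /eqP; rewrite eq_sym (negbTE (dr _ _)).
- by move=> /ir2 ->.
Qed.

Let glue (p : pathspace T J1 * pathspace T J2) : pathspace T (J1 + J2)%type :=
  fun k => match k with inl i => p.1 i | inr j => p.2 j end.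

Let mglue : measurable_fun setT glue.
Proof.
apply: measurable_fun_path => -[i|j].
- by apply: (measurableT_comp (measurable_coord i)).
- by apply: (measurableT_comp (measurable_coord j)).
Qed.

HB.instance Definition _ := isMeasurableFun.Build _ _ _ _ glue mglue.

(** On a cylinder both sides are products of marginals; [pmap] splits the list into its left and its
    right indices. *)
Let law_glue B : measurable B ->
  law (e \o r) B = pushforward (law e1 \x law e2) glue B.
Proof.
apply: path_measure_unique => s A us mA.
rewrite law_cylinder//; last exact: inj_comp.
pose f1 (k : J1 + J2) := if k is inl i then Some i else None.
pose f2 (k : J1 + J2) := if k is inr j then Some j else None.
have ms1 i : (i \in pmap f1 s) = (inl i \in s).
  rewrite mem_pmap; apply/mapP/idP => [[[k|k] ks //= [->]] //|ks].
  by exists (inl i).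
have ms2 j : (j \in pmap f2 s) = (inr j \in s).
  rewrite mem_pmap; apply/mapP/idP => [[[k|k] ks //= [->]] //|ks].
  by exists (inr j).
have us1 : uniq (pmap f1 s) by apply: (@pmap_uniq _ _ f1 inl) => // -[].
have us2 : uniq (pmap f2 s) by apply: (@pmap_uniq _ _ f2 inr) => // -[].
have E : glue @^-1` cylinder s A =
    cylinder (pmap f1 s) (A \o inl) `*` cylinder (pmap f2 s) (A \o inr).
  apply/seteqP; split => -[u w] /=.
    move=> H; split => k; rewrite ?ms1 ?ms2 => ks; exact: (H _ ks).
  by move=> [H1 H2] [i|j] ks /=; [apply: H1|apply: H2]; rewrite ?ms1 ?ms2.
transitivity ((law e1 \x law e2)
    (cylinder (pmap f1 s) (A \o inl) `*` cylinder (pmap f2 s) (A \o inr))); last first.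
  by rewrite -E.
rewrite product_measure1E; [|by apply: measurable_cylinder => ?; exact: mA..].
transitivity ((\prod_(i <- pmap f1 s) marginal X (A (inl i))) *
    \prod_(j <- pmap f2 s) marginal X (A (inr j))); last first.
  by congr (_ * _); apply/esym; apply: law_cylinder => // ?; exact: mA.
elim: (s) => [|[k|k] s' IH]; first by rewrite !big_nil mul1e.
  by rewrite /= !big_cons IH muleA.
by rewrite /= !big_cons IH muleCA.
Qed.

Lemma law_block (A : set (pathspace T J1)) (B : set (pathspace T J2)) :
  measurable A -> measurable B ->
  law e (shift r1 @^-1` A `&` shift r2 @^-1` B) = law e1 A * law e2 B.
Proof.
move=> mA mB.
have mAB : measurable
    ((shift inl @^-1` A `&` shift inr @^-1` B) : set (pathspace T (J1 + J2)%type)).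
  by apply: measurableI; rewrite -[X in measurable X]setTI; exact: measurable_shift.
transitivity (law (e \o r) (shift inl @^-1` A `&` shift inr @^-1` B)) => //.
by rewrite (law_glue mAB) -[RHS](product_measure1E _ _ mA mB).
Qed.

Lemma Ex_mul_block (F : pathspace T J1 -> R) (G : pathspace T J2 -> R) :
  integ (law e1) F -> integ (law e2) G ->
  Ex (law e) (fun v => F (shift r1 v) * G (shift r2 v))%R =
  (Ex (law e1) F * Ex (law e2) G)%R.
Proof.
move=> iF iG.
have mF := integ_mfun iF; have mG := integ_mfun iG.
pose H (p : pathspace T J1 * pathspace T J2) : \bar R := (F p.1 * G p.2)%:E.
have mH : measurable_fun setT H.
  apply/measurable_EFinP; apply: measurable_funM.
    exact: (measurableT_comp mF).
  exact: (measurableT_comp mG).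
(* Fubini needs joint integrability first; it follows from the iterated integral of the absolute
   values, which factors. *)
have iH : (law e1 \x law e2).-integrable setT H.
  apply: (integrable12ltyP (law e1) (law e2) mH).2.
  have iF' := integ_norm iF; have iG' := integ_norm iG.
  rewrite (eq_integral (fun x => (`|F x| * Ex (law e2) (fun y => `|G y|))%:E)).
    have := integZ (Ex (law e2) (fun y => `|G y|))%R iF'.
    move/integrableP => [_]; apply: le_lt_trans.
    apply: ge0_le_integral => //.
    - by move=> x _; rewrite lee_fin mulr_ge0// Ex_ge0.
    - apply/measurable_EFinP; apply: measurable_funM => //.
      exact: measurableT_comp.
    - apply/measurableT_comp => //; apply/measurable_EFinP; apply: measurable_funM => //.
      exact: measurableT_comp.
    - by move=> x _; rewrite /= lee_fin mulrC ler_norm.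
  move=> x _; rewrite EFinM /Ex /Rintegral fineK; last exact: integrable_fin_num.
  rewrite -integralZl//; apply: eq_integral => y _.
  by rewrite /H /= normrM EFinM.
pose Hs (v : pathspace T (J1 + J2)%type) : \bar R := (F (shift inl v) * G (shift inr v))%:E.
have mHs : measurable_fun setT Hs.
  apply/measurable_EFinP; apply: measurable_funM.
    by apply: (measurableT_comp mF); exact: measurable_shift.
  by apply: (measurableT_comp mG); exact: measurable_shift.
have E : \int[law e]_v (F (shift r1 v) * G (shift r2 v))%:E =
    \int[law e1 \x law e2]_p H p.
  transitivity (\int[law (e \o r)]_v Hs v).
    rewrite -(integral_shift ie (inj_comp ie ir) ir mHs).
    exact: eq_integral.
  transitivity (\int[pushforward (law e1 \x law e2) glue]_v Hs v).
    by apply: eq_measure_integral => B mB _; exact: law_glue.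
  by rewrite integral_pushforward.
rewrite /Ex /Rintegral E -integral12_prod_meas1//.
rewrite (eq_integral (fun x => (F x * Ex (law e2) G)%:E)).
  by rewrite -[LHS]/(Rintegral _ _ (fun x => F x * Ex (law e2) G)%R) RintegralZr.
move=> x _; rewrite EFinM /Ex /Rintegral fineK; last exact: integrable_fin_num.
by rewrite -integralZl.
Qed.

End Blocks.
End Exchangeability.

(** * Copies of the sample and the Efron-Stein bound *)

Section Copies.
Context {R : realType} {dT : measure_display} {T : measurableType dT} {n : nat}.
Notation I := (nat * 'I_n)%type.

(* A point [v] is a sequence of independent copies of the sample; [v (c, k)] is
   the coordinate [k] of the copy [c]. *)
Record iid_copies (Q : probability (pathspace T I) R) : Prop := IidCopies {
  integral_reindex : forall (r : I -> I) (f : pathspace T I -> \bar R),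
    injective r -> measurable_fun setT f ->
    (\int[Q]_v f (shift r v) = \int[Q]_v f v)%E ;
  Ex_block : forall (r1 r2 : I -> I) (F G : pathspace T I -> R),
    injective r1 -> injective r2 -> (forall i j, r1 i != r2 j) ->
    integ Q F -> integ Q G ->
    Ex Q (fun v => F (shift r1 v) * G (shift r2 v)) = Ex Q F * Ex Q G ;
  integral_coords : forall m (s s' : 'I_m -> I) (f : m.-tuple T -> \bar R),
    injective s -> injective s' -> measurable_fun setT f ->
    (\int[Q]_v f (coords s v) = \int[Q]_v f (coords s' v))%E }.

(** Coordinate [k] is read from copy [a k], so every configuration with some coordinates resampled
    has this form. *)
Definition pt (a : 'I_n -> nat) (v : pathspace T I) : n.-tuple T :=
  coords (fun k => (a k, k)) v.

Lemma measurable_pt a : measurable_fun setT (pt a).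
Proof. exact: measurable_coords. Qed.

Lemma pt_eq a b v : a =1 b -> pt a v = pt b v.
Proof. by move=> ab; apply: eq_from_tnth => k; rewrite !tnth_mktuple ab. Qed.

Lemma replace_pt a b (A : {set 'I_n}) v :
  replace (pt a v) (pt b v) A = pt (fun k => if k \in A then b k else a k) v.
Proof.
by apply: eq_from_tnth => k; rewrite !tnth_mktuple; case: ifP.
Qed.

(** Copies are renamed separately in each coordinate. Swapping X_j with X'_j is the case where only
    coordinate [j] is affected. *)
Definition relabel (p : 'I_n -> nat -> nat) (ck : I) : I := (p ck.2 ck.1, ck.2).

Lemma relabel_inj p : (forall k, injective (p k)) -> injective (relabel p).
Proof. by move=> ip [c k] [c' k'] [] /[swap] -> /ip ->. Qed.

Lemma pt_relabel p a v : pt a (shift (relabel p) v) = pt (fun k => p k (a k)) v.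
Proof. by apply: eq_from_tnth => k; rewrite !tnth_mktuple. Qed.

Definition swapn (a b c : nat) : nat :=
  if c == a then b else if c == b then a else c.

Lemma swapnK a b : involutive (swapn a b).
Proof.
move=> c; rewrite /swapn.
case: (eqVneq c a) => [->|ca]; first by rewrite eqxx; case: eqVneq.
case: (eqVneq c b) => [->|cb]; first by rewrite eqxx.
by rewrite (negbTE ca) (negbTE cb).
Qed.

Lemma swapn_inj a b : injective (swapn a b).
Proof. exact: inv_inj (swapnK a b). Qed.

Lemma swapnL a b : swapn a b a = b.
Proof. by rewrite /swapn eqxx. Qed.

Lemma swapnR a b : swapn a b b = a.
Proof. by rewrite /swapn eqxx; case: eqP. Qed.

Lemma swapnD a b c : c != a -> c != b -> swapn a b c = c.
Proof. by rewrite /swapn => /negbTE -> /negbTE ->. Qed.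

Context (Q : probability (pathspace T I) R) (iidQ : iid_copies Q).
Notation E := (Ex Q).
Implicit Types (F G : pathspace T I -> R) (p : 'I_n -> nat -> nat).

Lemma Ex_relabel p F : (forall k, injective (p k)) -> measurable_fun setT F ->
  E (fun v => F (shift (relabel p) v)) = E F.
Proof.
move=> ip mF; rewrite /Ex /Rintegral.
rewrite -(integral_reindex iidQ (relabel_inj ip) (f := EFin \o F))//.
exact/measurable_EFinP.
Qed.

Lemma integ_reindex r F : injective r -> integ Q F ->
  integ Q (fun v => F (shift r v)).
Proof.
move=> ir iF; have mF := integ_mfun iF.
have mFr : measurable_fun setT (fun v => F (shift r v)).
  by apply: (measurableT_comp mF); exact: measurable_shift.
move/integrableP : iF => [_ iF].
apply/integrableP; split; first exact/measurable_EFinP.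
have mabs : measurable_fun setT (fun v => `|(F v)%:E|%E).
  by apply: measurableT_comp => //; exact/measurable_EFinP.
by rewrite (integral_reindex iidQ ir mabs).
Qed.

Lemma integ_relabel p F : (forall k, injective (p k)) -> integ Q F ->
  integ Q (fun v => F (shift (relabel p) v)).
Proof. by move=> ip; apply: integ_reindex; exact: relabel_inj. Qed.

Lemma L2_relabel p F : (forall k, injective (p k)) -> L2 Q F ->
  L2 Q (fun v => F (shift (relabel p) v)).
Proof.
move=> ip [mF iF]; split.
  by apply: (measurableT_comp mF); exact: measurable_shift.
exact: (integ_relabel ip iF).
Qed.

(** For [a != b], a permutation of the copies sending 0 to [a] and 1 to [b]. It carries (X, X') to
    any two points that use different copies in each coordinate. *)
Definition swap2 (a b c : nat) : nat := swapn 0 a (swapn 1 (swapn 0 a b) c).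

Lemma swap2_inj a b : injective (swap2 a b).
Proof. by apply: inj_comp; exact: swapn_inj. Qed.

Lemma swap2_0 a b : a != b -> swap2 a b 0 = a.
Proof.
move=> ab; rewrite /swap2 [swapn 1 _ 0]swapnD ?swapnL//.
rewrite -[X in X != _](swapnR 0 a); apply: contra_neq ab; exact: swapn_inj.
Qed.

Lemma swap2_1 a b : swap2 a b 1 = b.
Proof.
by rewrite /swap2 swapnL swapnK.
Qed.

Definition copy (c : nat) : 'I_n -> nat := fun=> c.

Section Pairs.
Variables (S : n.-tuple T * n.-tuple T -> R) (a b : 'I_n -> nat).
Hypotheses (mS : measurable_fun setT S) (ab : forall k, a k != b k).

Lemma measurable_pair a' b' : measurable_fun setT (fun v => S (pt a' v, pt b' v)).
Proof.
apply: (measurableT_comp mS); apply: measurable_fun_pair; exact: measurable_pt.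
Qed.

Let pairE : (fun v => S (pt a v, pt b v)) = (fun v =>
  (fun v => S (pt (copy 0) v, pt (copy 1) v))
  (shift (relabel (fun k => swap2 (a k) (b k))) v)).
Proof.
apply/funext => v; rewrite !pt_relabel; congr (S (_, _)); apply: pt_eq => k.
  by rewrite swap2_0.
by rewrite swap2_1.
Qed.

Lemma Ex_pair : E (fun v => S (pt a v, pt b v)) =
  E (fun v => S (pt (copy 0) v, pt (copy 1) v)).
Proof.
rewrite pairE; apply: (@Ex_relabel _ (fun v => S (pt (copy 0) v, pt (copy 1) v))).
  by move=> k; exact: swap2_inj.
exact: measurable_pair.
Qed.

Lemma integ_pair : integ Q (fun v => S (pt (copy 0) v, pt (copy 1) v)) ->
  integ Q (fun v => S (pt a v, pt b v)).
Proof.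
by move=> iS; rewrite pairE; apply: integ_relabel iS => k; exact: swap2_inj.
Qed.

Lemma L2_pair : L2 Q (fun v => S (pt (copy 0) v, pt (copy 1) v)) ->
  L2 Q (fun v => S (pt a v, pt b v)).
Proof.
by move=> LS; rewrite pairE; apply: L2_relabel LS => k; exact: swap2_inj.
Qed.

End Pairs.

(** * Efron-Stein bound for the covariance with a bounded function *)

Section BoundedCovariance.
Variables (S : n.-tuple T * n.-tuple T -> R) (phi : n.-tuple T -> R) (c : R).
Hypotheses (mS : measurable_fun setT S) (mphi : measurable_fun setT phi).
Hypothesis phic : forall x, `|phi x| <= c.

Let U (a b : 'I_n -> nat) v := S (pt a v, pt b v).
Notation Z := copy.

Hypothesis LS : L2 Q (U (Z 0) (Z 1)).

Let U_relabel p a b v :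
  U a b (shift (relabel p) v) = U (fun k => p k (a k)) (fun k => p k (b k)) v.
Proof. by rewrite /U !pt_relabel. Qed.

Let m : R := E (U (Z 0) (Z 1)).
Let H (k : nat) v := U (Z 0) (Z k) v - m.

Let LU a b : (forall k, a k != b k) -> L2 Q (U a b).
Proof. by move=> ab; exact: (L2_pair ab LS). Qed.

Let LH k : k != 0%N -> L2 Q (H k).
Proof.
by move=> k0; apply: L2B (L2_cst _ _); apply: LU => j; rewrite eq_sym.
Qed.

Let Lphi k F : L2 Q F -> L2 Q (fun v => phi (pt (Z k) v) * F v).
Proof.
move=> LF; apply: (L2_bounded_mul (c := c)) => //.
by apply: (measurableT_comp mphi); exact: measurable_pt.
Qed.

(** An injection fixing 0 and sending 1 to [a] and 3 to [b]; the shift by [a + b] keeps the other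
    values apart from these. *)
Let ext (a b k : nat) : nat :=
  if k == 0%N then 0%N else if k == 1%N then a else if k == 3%N then b else (k + a + b)%N.

Let ext_inj a b : a != 0%N -> b != 0%N -> a != b -> injective (ext a b).
Proof.
move=> a0 b0 ab x y; rewrite /ext.
by do ?[case: ifP => /eqP ?]; lia.
Qed.

(** Given copy 0, [H 1] and [H 3] are independent with the same law, so this is the variance of
    E(S(X, X') | X). Copy 2 is reserved for resampling X. *)
Let gamma := E (fun v => H 1 v * H 3 v).

Let E_phiH k : k != 0%N ->
  E (fun v => phi (pt (Z 0) v) * H k v) = E (fun v => phi (pt (Z 0) v) * H 1 v).
Proof.
move=> k0; have s0 : swapn 1 k 0 = 0%N by rewrite swapnD// eq_sym.
rewrite -(Ex_relabel (p := fun=> swapn 1 k)).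
- congr Ex; apply/funext => v; rewrite /H U_relabel pt_relabel.
  congr (phi _ * (S (_, _) - _)); apply: pt_eq => j;
    by rewrite /Z ?swapnL ?swapnR ?s0.
- by move=> _; exact: swapn_inj.
- exact: (Lphi _ (LH _)).1.
Qed.

Let E_H2 k : k != 0%N -> E (fun v => H k v ^+ 2) = E (fun v => H 1 v ^+ 2).
Proof.
move=> k0; have s0 : swapn 1 k 0 = 0%N by rewrite swapnD// eq_sym.
rewrite -(Ex_relabel (p := fun=> swapn 1 k)).
- congr Ex; apply/funext => v; rewrite /H U_relabel.
  congr ((S (_, _) - _) ^+ _); apply: pt_eq => j;
    by rewrite /Z ?swapnL ?swapnR ?s0.
- by move=> _; exact: swapn_inj.
- by apply: measurable_funX; exact: (LH _).1.
Qed.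

Let E_HH k l : k != 0%N -> l != 0%N -> k != l ->
  E (fun v => H k v * H l v) = gamma.
Proof.
move=> k0 l0 kl; rewrite /gamma -[RHS](Ex_relabel (p := fun=> ext k l))//.
- by move=> _; exact: ext_inj.
- by apply: measurable_funM; apply: (LH _).1.
Qed.

(** Replacing [H 1] by the average of [H 1], ..., [H (N + 1)] keeps the left expectation, while the
    second moment of the average is [gamma + (b - gamma) / (N + 1)]. Cauchy-Schwarz and large [N]
    give the claim. *)
Let phiH_sq_le : E (fun v => phi (pt (Z 0) v) * H 1 v) ^+ 2 <= c ^+ 2 * gamma.
Proof.
set al := E _; set b := E (fun v => H 1 v ^+ 2).
have c0 : 0 <= c.
  by have := phic (pt (Z 0) (fun=> point)); exact: le_trans.
(* Were the bracket positive, the left side would be unbounded in [N]. *)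
suff main N : N.+1%:R * (al ^+ 2 - c ^+ 2 * gamma) <= c ^+ 2 * (b - gamma).
  rewrite -subr_le0 leNgt; apply/negP => pos.
  pose q := c ^+ 2 * (b - gamma) / (al ^+ 2 - c ^+ 2 * gamma).
  have := main (Num.bound `|q|); rewrite leNgt -ltr_pdivrMr// -/q.
  rewrite (le_lt_trans (ler_norm _))// (lt_trans (archi_boundP (normr_ge0 _)))//.
  by rewrite ltr_nat.
pose V v := \sum_(k < N.+1) H k.+1 v.
have LV : L2 Q V by apply: L2_sum => k _; exact: LH.
have EphiV : E (fun v => phi (pt (Z 0) v) * V v) = N.+1%:R * al.
  rewrite (_ : (fun v => _) = fun v => \sum_(k < N.+1) phi (pt (Z 0) v) * H k.+1 v).
    rewrite Ex_sum; last by move=> k _; exact/L2_integ/Lphi/LH.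
    by under eq_bigr do rewrite E_phiH//; rewrite sumr_const card_ord mulr_natl.
  by apply/funext => v; rewrite mulr_sumr.
have EV2 : E (fun v => V v ^+ 2) = N.+1%:R ^+ 2 * gamma + N.+1%:R * (b - gamma).
  rewrite (_ : (fun v => _) = fun v =>
    \sum_(k < N.+1) \sum_(l < N.+1) H k.+1 v * H l.+1 v); last first.
    by apply/funext => v; rewrite expr2 mulr_suml; apply: eq_bigr => k _; rewrite mulr_sumr.
  rewrite Ex_sum; last by move=> k _; apply: integ_sum => l _; apply: L2_mul; exact: LH.
  transitivity (\sum_(k < N.+1) (N.+1%:R * gamma + (b - gamma))).
    apply: eq_bigr => k _.
    rewrite Ex_sum; last by move=> l _; apply: L2_mul; exact: LH.
    rewrite (bigD1 k)//= (eq_bigr (fun=> gamma)); last first.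
      by move=> l lk; apply: E_HH => //; rewrite eqSS eq_sym.
    rewrite sumr_const cardC1 card_ord.
    rewrite (_ : (fun v => H k.+1 v * H k.+1 v) = (fun v => H k.+1 v ^+ 2)); last first.
      by apply/funext => v; rewrite expr2.
    rewrite E_H2// -/b -(mulr_natl gamma N) -natr1; ring.
  rewrite sumr_const card_ord -mulr_natl; ring.
have Lp : L2 Q (fun v => phi (pt (Z 0) v)).
  rewrite (_ : (fun v => _) = fun v => phi (pt (Z 0) v) * cst 1 v).
    by apply: Lphi; exact: L2_cst.
  by apply/funext => v; rewrite mulr1.
have := cauchy_schwarz Lp LV; rewrite EphiV EV2.
have phi2 : E (fun v => phi (pt (Z 0) v) ^+ 2) <= c ^+ 2.
  rewrite -[leRHS](Ex_cst Q); apply: Ex_le; [exact: Lp.2|exact: integ_cst|].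
  move=> v; rewrite -[leLHS]real_normK ?num_real// lerXn2r ?nnegrE//; exact: phic.
have V0 : 0 <= N.+1%:R ^+ 2 * gamma + N.+1%:R * (b - gamma).
  by rewrite -EV2; apply: Ex_ge0 => v; exact: sqr_ge0.
move=> /le_trans /(_ (ler_wpM2r V0 phi2)).
have N0 : 0 < N.+1%:R :> R by rewrite ltr0n.
move: (N.+1%:R) N0 => N' N0 le1.
rewrite -(ler_pM2l N0); move: le1; nra.
Qed.

Let Y (i k : 'I_n) : nat := if k == i then 2 else 0.
Let D i v := U (Z 0) (Z 1) v - U (Y i) (Z 1) v.

Let gammaE : gamma = E (fun v => U (Z 0) (Z 1) v * (U (Z 0) (Z 3) v - U (Z 2) (Z 3) v)).
Proof.
have L01 : L2 Q (U (Z 0) (Z 1)) by exact: LU.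
have L03 : L2 Q (U (Z 0) (Z 3)) by exact: LU.
have L23 : L2 Q (U (Z 2) (Z 3)) by exact: LU.
have m03 : E (U (Z 0) (Z 3)) = m by exact: Ex_pair.
have m2 : E (fun v => U (Z 0) (Z 1) v * U (Z 2) (Z 3) v) = m * m.
  (* The ranges of [g1] and [g2] are disjoint: 0, 1 and the even numbers from 4 on, against 2, 3 and
     the odd numbers from 5 on. The pairs (0, 1) and (2, 3) thus lie in independent blocks. *)
  pose g1 (c : nat) : nat := if (c <= 1)%N then c else (2 * c)%N.
  pose g2 (c : nat) : nat := if (c <= 1)%N then (c + 2)%N else (2 * c + 1)%N.
  rewrite /m -(Ex_block iidQ (r1 := relabel (fun=> g1)) (r2 := relabel (fun=> g2)))//.
  - by apply: relabel_inj => _ x y; rewrite /g1; do 2 case: ifP; lia.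
  - by apply: relabel_inj => _ x y; rewrite /g2; do 2 case: ifP; lia.
  - move=> [x i] [y j]; apply/eqP => -[+ _]; rewrite /g1 /g2/=.
    by do 2 case: ifP; lia.
  - exact: L2_integ.
  - exact: L2_integ.
transitivity (E (fun v => U (Z 0) (Z 1) v * U (Z 0) (Z 3) v) - m * m).
  rewrite /gamma /H.
  rewrite (_ : (fun v => _) = fun v => U (Z 0) (Z 1) v * U (Z 0) (Z 3) v -
      (m * U (Z 0) (Z 1) v + (m * U (Z 0) (Z 3) v - m * m))); last first.
    by apply/funext => v; ring.
  have iZ F : L2 Q F -> integ Q (fun v => m * F v) by move=> LF; exact/integZ/L2_integ.
  have ic : integ Q (fun=> m * m) by exact: integ_cst.
  rewrite ExB; [|exact: L2_mul|by apply: integD; [exact: iZ|apply: integB => //; exact: iZ]].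
  rewrite ExD; [|exact: iZ|by apply: integB => //; exact: iZ].
  rewrite ExB//; last exact: iZ.
  rewrite (ExZ m (L2_integ L01)) (ExZ m (L2_integ L03)).
  by rewrite -/m (Ex_cst Q (m * m)) m03; ring.
rewrite -m2 -ExB; [|exact: L2_mul..].
by congr Ex; apply/funext => v; rewrite mulrBr.
Qed.

(** Moving coordinates one at a time from copy 0 to copy 2 splits the difference in [gammaE] into
    the [D' i]. Swapping the two copies in coordinate [i] alone negates [D' i], so the other factor
    may be replaced by half of [D i]; [D i] and [D' i] have the same second moment. *)
Let gamma_le : gamma <= 2^-1 * \sum_(i < n) E (fun v => D i v ^+ 2).
Proof.
pose z (i : nat) (k : 'I_n) : nat := if (k < i)%N then 2 else 0.
pose D' i v := U (z i) (Z 3) v - U (z i.+1) (Z 3) v.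
have LD' i : L2 Q (D' i).
  by apply: L2B; apply: LU => k; rewrite /z /Z; case: ifP.
have LD i : L2 Q (D i).
  by apply: L2B; apply: LU => k; rewrite /Y /Z//; case: ifP.
have L01 : L2 Q (U (Z 0) (Z 1)) by exact: LU.
have LY i : L2 Q (U (Y i) (Z 1)) by apply: LU => k; rewrite /Y; case: ifP.
have -> : gamma = \sum_(i < n) E (fun v => U (Z 0) (Z 1) v * D' i v).
  rewrite gammaE -Ex_sum; last by move=> i _; exact: L2_mul.
  congr Ex; apply/funext => v; rewrite -mulr_sumr; congr (_ * _).
  rewrite -(big_mkord xpredT (fun i => D' i v)).
  rewrite (eq_bigr (fun i => - (U (z i.+1) (Z 3) v - U (z i) (Z 3) v))); last first.
    by move=> i _; rewrite opprB.
  rewrite sumrN telescope_sumr// opprB; congr (S (_, _) - S (_, _)); apply: pt_eq => k.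
  by rewrite /z ltn_ord.
rewrite mulr_sumr; apply: ler_sum => i _.
have anti : E (fun v => U (Z 0) (Z 1) v * D' i v) =
    - E (fun v => U (Y i) (Z 1) v * D' i v).
  rewrite -ExN; last exact: L2_mul.
  pose p (k : 'I_n) := if k == i then swapn 0 2 else id.
  rewrite -(Ex_relabel (p := p)); last 2 first.
  - by move=> k; rewrite /p; case: ifP => _; [exact: swapn_inj|exact: inj_id].
  - exact: (integ_mfun (L2_mul L01 (LD' i))).
  congr Ex; apply/funext => v; rewrite /D' !U_relabel -mulrN opprB.
  congr (S (_, _) * (S (_, _) - S (_, _))); apply: pt_eq => k;
    rewrite /p /Y /z /copy -?val_eqE /=; do ?[case: ifP => /= ?]; rewrite /swapn /=; lia.
(* Renaming copy 1 as 3, and swapping 0 with 2 in the coordinates before [i], turns [D i] into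
   [D' i]. *)
have sq : E (fun v => D' i v ^+ 2) = E (fun v => D i v ^+ 2).
  pose p (k : 'I_n) := (if (k < i)%N then swapn 0 2 else id) \o swapn 1 3.
  rewrite -[RHS](Ex_relabel (p := p)); last 2 first.
  - move=> k; rewrite /p; apply: inj_comp; last exact: swapn_inj.
    by case: ifP => _; [exact: swapn_inj|exact: inj_id].
  - exact: (integ_mfun (LD i).2).
  congr Ex; apply/funext => v; rewrite /D' /D !U_relabel.
  congr ((S (_, _) - S (_, _)) ^+ 2); apply: pt_eq => k;
    rewrite /p /Y /z /copy -?val_eqE /=; do ?[case: ifP => /= ?]; rewrite /swapn /=; lia.
have -> : E (fun v => U (Z 0) (Z 1) v * D' i v) = 2^-1 * E (fun v => D i v * D' i v).
  rewrite (_ : (fun v => D i v * D' i v) = fun v => U (Z 0) (Z 1) v * D' i v -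
    U (Y i) (Z 1) v * D' i v); last by apply/funext => v; rewrite -mulrBl.
  by rewrite ExB; [rewrite -[X in _ - X]opprK -anti; field|exact: L2_mul..].
rewrite ler_pM2l ?invr_gt0//.
have := LD i; have := LD' i => -[_ iD'2] [_ iD2].
have : E (fun v => D i v * D' i v) <= E (fun v => 2^-1 * (D i v ^+ 2 + D' i v ^+ 2)).
  apply: Ex_le; [exact: L2_mul|by apply: integZ; exact: integD|].
  by move=> v; have := sqr_ge0 (D i v - D' i v); lra.
rewrite ExZ; last exact: integD.
rewrite ExD// sq; lra.
Qed.

Lemma bounded_covariance_sq_le :
  E (fun v => phi (pt (copy 0) v) * (S (pt (copy 0) v, pt (copy 1) v) -
      E (fun v => S (pt (copy 0) v, pt (copy 1) v)))) ^+ 2 <=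
  c ^+ 2 * (2^-1 * \sum_(i < n) E (fun v =>
    (S (pt (copy 0) v, pt (copy 1) v) -
     S (pt (fun k => if k == i then 2 else 0) v, pt (copy 1) v)) ^+ 2)).
Proof.
apply: (le_trans phiH_sq_le).
by apply: ler_wpM2l; [exact: sqr_ge0|exact: gamma_le].
Qed.

End BoundedCovariance.
End Copies.

(** * Averaging over replacement sets *)

Section SubsetTelescoping.
Context {R : realType} {n : nat}.
Implicit Types (A B : {set 'I_n}) (F : {set 'I_n} -> R).

(* [subset_weight A = \int_0^1 t^|A| (1 - t)^(n - |A|) dt]: choose [t] uniformly,
   then put each index in [A] independently with probability [t]. *)
Definition subset_weight A : R := ((#|A|)`! * (n - #|A|)`!)%:R / (n.+1)`!%:R.

Lemma subset_weight_ge0 A : 0 <= subset_weight A.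
Proof. by rewrite divr_ge0. Qed.

(** The same integral for the [n - 1] indices other than a given [j]: the probability that the
    random set, with [j] removed, equals [A]. *)
Let step_weight A : R := ((#|A|)`! * (n - #|A|).-1`!)%:R / n`!%:R.

Let max_card_set A : (#|A| <= n)%N.
Proof. by rewrite -[X in (_ <= X)%N](card_ord n) max_card. Qed.

Let notin_card_lt A j : j \notin A -> (#|A| < n)%N.
Proof. by move=> jA; have := max_card_set (j |: A); rewrite cardsU1 jA. Qed.

Let step_weightE A j : j \notin A ->
  subset_weight A + subset_weight (j |: A) = step_weight A.
Proof.
move=> jA; have An := notin_card_lt jA.
rewrite /subset_weight /step_weight cardsU1 jA add1n -mulrDl -natrD.
move: (#|A|) An => a an.
have -> : (n - a = (n - a.+1).+1)%N by lia.
have : n.+1 = ((n - a.+1).+1 + a.+1)%N by lia.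
move: (n - a.+1)%N => b nE.
rewrite /= (_ : _ + _ = n.+1 * (a`! * b`!))%N; last first.
  rewrite nE mulnDl !factS; congr (_ + _)%N; [exact: mulnCA|exact/esym/mulnA].
rewrite [(n.+1)`!]factS !natrM invfM mulrACA divff ?mul1r//.
Qed.

Lemma sum_setU1 (j : 'I_n) (g : {set 'I_n} -> R) :
  \sum_(A : {set 'I_n} | j \in A) g A = \sum_(A : {set 'I_n} | j \notin A) g (j |: A).
Proof.
rewrite (reindex_onto (fun A : {set 'I_n} => j |: A) (fun A => A :\ j)) /=.
  apply: eq_bigl => A; rewrite finset.setU11/=; apply/eqP/idP => [<-|/finset.setU1K//].
  by rewrite !inE eqxx.
by move=> A jA; rewrite finset.setD1K.
Qed.

(** After collecting terms, [F A] receives [u A], the inverse of the binomial coefficient of [n] and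
    [#|A|], once with each sign. The positive part misses only the full set, which has no index
    outside it, and the negative part only the empty set. *)
Lemma subset_telescope F :
  \sum_A subset_weight A * (\sum_j (F (A :\ j) - F (j |: A))) =
  F finset.set0 - F [set: 'I_n]%SET.
Proof.
pose u A : R := ((#|A|)`! * (n - #|A|)`!)%:R / n`!%:R.
transitivity (\sum_j \sum_(A : {set 'I_n} | j \notin A)
    step_weight A * (F A - F (j |: A))).
  under eq_bigr do rewrite mulr_sumr.
  rewrite exchange_big /=; apply: eq_bigr => j _.
  rewrite (bigID (fun A : {set 'I_n} => j \in A))/= sum_setU1 addrC -big_split/=.
  apply: eq_bigr => A jA; rewrite finset.setU1K// finset.setUA finset.setUid
    -(step_weightE jA) mulrDl.
  by rewrite (_ : A :\ j = A)//; apply/finset.setDidPl; rewrite disjoint_sym disjoints1.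
transitivity (\sum_(A : {set 'I_n}) ((n - #|A|)%:R * step_weight A * F A) -
    \sum_(A : {set 'I_n}) (if A == finset.set0 then 0 else u A * F A)).
  under eq_bigr do (under eq_bigr do rewrite mulrBr; rewrite sumrB).
  rewrite sumrB; congr (_ - _).
    rewrite (exchange_big_dep xpredT)//=; apply: eq_bigr => A _.
    rewrite sumr_const -[LHS]mulr_natl mulrA; congr (_%:R * _ * _).
    transitivity #|(~: A)%SET|; first by apply: eq_card => j; rewrite !inE.
    by apply/eqP; rewrite -(eqn_add2l #|A|) cardsC card_ord subnKC.
  transitivity (\sum_j \sum_(A : {set 'I_n} | j \in A) step_weight (A :\ j) * F A).
    apply: eq_bigr => j _; rewrite sum_setU1; apply: eq_bigr => A jA.
    by rewrite finset.setU1K.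
  rewrite (exchange_big_dep xpredT)//=; apply: eq_bigr => A _.
  case: eqVneq => [->|]; first by rewrite big1// => j; rewrite inE.
  move=> /finset.set0Pn[j0 j0A].
  rewrite (eq_bigr (fun=> step_weight (A :\ j0) * F A)); last first.
    move=> j jA; rewrite /step_weight.
    have := cardsD1 j A; rewrite (cardsD1 j0 A) jA j0A !add1n => -[<-].
    by [].
  rewrite sumr_const -[LHS]mulr_natl mulrA; congr (_ * _).
  rewrite /step_weight /u mulrA -natrM; congr (_%:R / _).
  have := cardsD1 j0 A; rewrite j0A add1n => cA; have := max_card_set A.
  rewrite mulnA cA -factS => An; congr (_ * _`!)%N; lia.
rewrite (eq_bigr (fun A => if A == [set: 'I_n]%SET then 0 else u A * F A)); last first.
  (* At the full set the factor [n - #|A|] is 0, so the truncated predecessor in [step_weight] does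
     not matter. *)
  move=> A _; case: eqVneq => [->|AT]; first by rewrite cardsT card_ord subnn !mul0r.
  have An : (#|A| < n)%N.
    by move: AT; rewrite -finset.subTset => /fintype.subsetPn[j _]; exact: notin_card_lt.
  rewrite /step_weight /u mulrA -natrM; congr (_%:R / _ * _).
  by rewrite mulnCA; congr (_ * _)%N;
    case: (n - #|A|)%N (subn_gt0 #|A| n) => [|k]; rewrite ?An// factS.
have bigif B : \sum_(A : {set 'I_n}) (if A == B then 0 else u A * F A) =
    \sum_A u A * F A - u B * F B.
  rewrite (bigD1 B)//= eqxx add0r [in RHS](bigD1 B)//= [RHS]addrAC subrr add0r.
  by apply: eq_bigr => A /negbTE ->.
rewrite !bigif; move: (\sum_A _) => s.
rewrite /u cardsT card_ord cards0 subnn subn0 fact0 mul1n muln1 divff// !mul1r.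
ring.
Qed.

(** Telescoping is applied to [- #|A| / n], for which each inner sum is [n] times [1 / n]. *)
Lemma sum_subset_weight : (0 < n)%N -> \sum_A subset_weight A = 1.
Proof.
move=> n0; have := subset_telescope (fun A => - (#|A|%:R / n%:R)).
rewrite cards0 mul0r oppr0 cardsT card_ord divff ?pnatr_eq0 -?lt0n// sub0r opprK => <-.
apply: eq_bigr => A _; rewrite -[LHS]mulr1; congr (_ * _).
rewrite (eq_bigr (fun=> n%:R^-1)); last first.
  move=> j _; rewrite opprK addrC -mulrBl (cardsD1 j (j |: A)) finset.setU11.
  rewrite (_ : (j |: A) :\ j = A :\ j); last first.
    by apply/finset.setP => k; rewrite !inE; case: eqVneq.
  by rewrite natrD addrK mul1r.
by rewrite sumr_const card_ord -[RHS]mulr_natr mulVf// pnatr_eq0 -lt0n.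
Qed.

End SubsetTelescoping.

(** * Increments along a replacement set *)

Section Differences.
Context {R : realType} {dT : measure_display} {T : measurableType dT} {n : nat}.
Notation I := (nat * 'I_n)%type.
Implicit Types (A : {set 'I_n}) (i j k : 'I_n).

Lemma measurable_replace A : measurable_fun setT
  (fun p : n.-tuple T * n.-tuple T => replace p.1 p.2 A).
Proof.
apply/measurable_fun_tnthP => k.
case kA : (k \in A).
  rewrite (_ : _ \o _ = (fun x => tnth x k) \o snd).
    by apply: (measurableT_comp (measurable_tnth k)).
  by apply/funext => p /=; rewrite tnth_mktuple kA.
rewrite (_ : _ \o _ = (fun x => tnth x k) \o fst).
  by apply: (measurableT_comp (measurable_tnth k)).
by apply/funext => p /=; rewrite tnth_mktuple kA.
Qed.

Context (f : n.-tuple T -> R) (mf : measurable_fun setT f).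

Lemma measurable_Delta j : measurable_fun setT
  (fun p : n.-tuple T * n.-tuple T => Delta f j p.1 p.2).
Proof.
apply: measurable_funB; first by apply: (measurableT_comp mf).
by apply: (measurableT_comp mf); exact: measurable_replace.
Qed.

Lemma measurable_maxDelta : measurable_fun setT
  (fun p : n.-tuple T * n.-tuple T => maxDelta f p.1 p.2).
Proof.
rewrite /maxDelta; elim: (index_enum _) => [|j s IH].
  by under eq_fun do rewrite big_nil; exact: measurable_cst.
under eq_fun do rewrite big_cons.
apply: measurable_maxr => //; apply: measurableT_comp => //.
exact: measurable_Delta.
Qed.

Lemma Delta_le_max j x x' : `|Delta f j x x'| <= maxDelta f x x'.
Proof. by rewrite /maxDelta; exact: le_bigmax_cond. Qed.

Lemma maxDelta_ge0 x x' : 0 <= maxDelta f x x'.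
Proof. by rewrite /maxDelta; exact: bigmax_ge_id. Qed.

Definition setDelta A j (x x' : n.-tuple T) : R :=
  f (replace x x' (A :\ j)) - f (replace x x' (j |: A)).

(** Exchanging the coordinates in [A] between X and X' gives a pair with the same joint law. Up to
    sign, [setDelta] is the plain [Delta] of that pair, so moment bounds and the interaction rule
    carry over to it. *)
Lemma setDeltaE A j x x' : setDelta A j x x' =
  (-1) ^+ (j \in A) * Delta f j (replace x x' A) (replace x' x A).
Proof.
have E : replace (replace x x' A) (replace x' x A) [set j] =
    replace x x' (if j \in A then (A :\ j)%SET else (j |: A)%SET).
  apply: eq_from_tnth => k; rewrite !tnth_mktuple.
  by case jA : (j \in A); rewrite !inE; case: (eqVneq k j) => [->|kj] /=; rewrite ?jA.
rewrite /setDelta /Delta E; case: ifP => jA.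
  rewrite mulN1r opprB; congr (_ - f (replace _ _ _)).
  by apply/finset.setUidPr; rewrite finset.sub1set.
rewrite mul1r; congr (f (replace _ _ _) - _).
by apply/finset.setDidPl; rewrite disjoint_sym disjoints1 jA.
Qed.

Lemma setDelta_norm A j x x' :
  `|setDelta A j x x'| = `|Delta f j (replace x x' A) (replace x' x A)|.
Proof. by rewrite setDeltaE normrM normr_sign mul1r. Qed.

Lemma measurable_setDelta A j : measurable_fun setT
  (fun p : n.-tuple T * n.-tuple T => setDelta A j p.1 p.2).
Proof.
by apply: measurable_funB; apply: (measurableT_comp mf); exact: measurable_replace.
Qed.

Lemma setDelta_telescope x x' :
  \sum_(A : {set 'I_n}) subset_weight A * (\sum_j setDelta A j x x') = f x - f x'.
Proof.
rewrite (subset_telescope (fun A => f (replace x x' A))).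
congr (f _ - f _); apply: eq_from_tnth => k; rewrite tnth_mktuple.
  by rewrite finset.in_set0.
by rewrite finset.in_setT.
Qed.

End Differences.

(** * The covariance identity *)

Section Identity.
Context {R : realType} {dT : measure_display} {T : measurableType dT} {n : nat}.
Notation I := (nat * 'I_n)%type.
Context (Q : probability (pathspace T I) R) (iidQ : iid_copies Q).
Notation E := (Ex Q).
Implicit Types (A : {set 'I_n}) (i j k : 'I_n).
Context (f : n.-tuple T -> R) (mf : measurable_fun setT f).
Hypothesis Lf : L2 Q (fun v => f (pt (copy 0) v)).
Hypothesis Ef : E (fun v => f (pt (copy 0) v)) = 0.

Lemma L2_pt (g : n.-tuple T -> R) a : L2 Q (fun v => g (pt (copy 0) v)) ->
  L2 Q (fun v => g (pt a v)).
Proof.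
move=> Lg; pose S (p : n.-tuple T * n.-tuple T) := g p.1.
apply: (@L2_pair _ _ _ _ _ iidQ S a (fun k => (a k).+1) _ Lg) => k.
by rewrite neq_ltn ltnSn.
Qed.

Lemma L2_replace (g : n.-tuple T -> R) A :
  L2 Q (fun v => g (pt (copy 0) v)) ->
  L2 Q (fun v => g (replace (pt (copy 0) v) (pt (copy 1) v) A)).
Proof.
by move=> Lg; under eq_L2 do rewrite replace_pt; exact: (@L2_pt g).
Qed.

Lemma L2_setDelta A j : L2 Q (fun v => setDelta f A j (pt (copy 0) v) (pt (copy 1) v)).
Proof.
by apply: L2B; exact: (@L2_replace f).
Qed.

Lemma covariance_identity (g : n.-tuple T -> R) : measurable_fun setT g ->
  L2 Q (fun v => g (pt (copy 0) v)) ->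
  E (fun v => g (pt (copy 0) v) * f (pt (copy 0) v)) =
  \sum_(A : {set 'I_n}) subset_weight A * (2^-1 * \sum_j E (fun v =>
    Delta g j (pt (copy 0) v) (pt (copy 1) v) *
    setDelta f A j (pt (copy 0) v) (pt (copy 1) v))).
Proof.
move=> mg Lg.
have L1 : L2 Q (fun v => f (pt (copy 1) v)) by exact: L2_pt.
have g0 : E (fun v => g (pt (copy 0) v) * f (pt (copy 1) v)) = 0.
  rewrite -(mulr0 (E (fun v => g (pt (copy 0) v)))) -Ef.
  (* Even and odd copies are independent blocks; as [f] is centred, subtracting [f] at copy 1
     changes nothing. *)
  rewrite -(Ex_block iidQ (r1 := relabel (fun=> double))
    (r2 := relabel (fun=> succn \o double)))//.
  - by apply: relabel_inj => _; exact: double_inj.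
  - by apply: relabel_inj => _ x y /= [] /double_inj.
  - move=> [x i] [y j]; apply/eqP => -[/= + _] => /(congr1 odd).
    by rewrite /= !odd_double.
  - exact: L2_integ.
  - exact: L2_integ.
transitivity (E (fun v => g (pt (copy 0) v) * (f (pt (copy 0) v) - f (pt (copy 1) v)))).
  under [RHS]eq_Ex do rewrite mulrBr.
  by rewrite ExB ?g0 ?subr0//; exact: L2_mul.
under eq_Ex do rewrite -(setDelta_telescope f) mulr_sumr.
have iA A j : integ Q (fun v => g (pt (copy 0) v) *
    setDelta f A j (pt (copy 0) v) (pt (copy 1) v)).
  by apply: L2_mul => //; exact: L2_setDelta.
rewrite Ex_sum; last first.
  move=> A _; under eq_integ do rewrite mulrCA mulr_sumr.
  by apply: integZ; apply: integ_sum.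
apply: eq_bigr => A _; under eq_Ex do rewrite mulrCA mulr_sumr.
rewrite ExZ; last exact: integ_sum.
congr (_ * _); rewrite Ex_sum// mulr_sumr; apply: eq_bigr => j _.
pose p k : nat -> nat := if k == j then swapn 0 1 else id.
have iB : integ Q (fun v => g (replace (pt (copy 0) v) (pt (copy 1) v) [set j]) *
    setDelta f A j (pt (copy 0) v) (pt (copy 1) v)).
  apply: L2_mul; last exact: L2_setDelta.
  exact: (@L2_replace g).
(* The swap of copies 0 and 1 in coordinate [j] exchanges the configurations for [A :\ j] and
   [j |: A], hence the sign. *)
have anti : E (fun v => g (pt (copy 0) v) * setDelta f A j (pt (copy 0) v) (pt (copy 1) v)) =
  - E (fun v => g (replace (pt (copy 0) v) (pt (copy 1) v) [set j]) *
    setDelta f A j (pt (copy 0) v) (pt (copy 1) v)).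
  rewrite -ExN// -[LHS](Ex_relabel iidQ (p := p)); last 2 first.
  - by move=> k; rewrite /p; case: ifP => _; [exact: swapn_inj|exact: inj_id].
  - exact: integ_mfun (iA A j).
  congr Ex; apply/funext => v; rewrite -mulrN /setDelta opprB !replace_pt !pt_relabel.
  congr (g _ * (f _ - f _)); apply: pt_eq => k;
    rewrite /p /copy !inE; case: eqVneq => //= ->; rewrite ?eqxx//=.
under [in RHS]eq_Ex do rewrite /Delta mulrBl.
by rewrite ExB// -[X in _ - X]opprK -anti; field.
Qed.

End Identity.

Lemma exprn_le1D {R : realDomainType} (u a : R) (k m : nat) : 0 <= u -> u <= a ->
  (k <= m)%N -> u ^+ k <= 1 + a ^+ m.
Proof.
move=> u0 ua km; have a0 : 0 <= a by exact: le_trans ua.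
apply: (le_trans (lerXn2r k _ _ ua)); rewrite ?nnegrE//.
have [a1|/ltW a1] := leP a 1.
  by rewrite (le_trans (exprn_ile1 k a0 a1))// lerDl exprn_ge0.
by rewrite (le_trans (ler_weXn2l a1 km))// lerDr.
Qed.

Lemma sqrM_le_1D8 {R : realFieldType} (u w a b : R) : 0 <= u -> u <= a ->
  0 <= w -> w <= b -> u ^+ 2 * w ^+ 2 <= 1 + (a ^+ 8 + b ^+ 8).
Proof.
move=> u0 ua w0 wb.
have u4 := exprn_le1D u0 ua (isT : 4 <= 8)%N.
have w4 := exprn_le1D w0 wb (isT : 4 <= 8)%N.
have := sqr_ge0 (u ^+ 2 - w ^+ 2).
rewrite (_ : (u ^+ 2 - w ^+ 2) ^+ 2 = u ^+ 4 + w ^+ 4 - 2 * (u ^+ 2 * w ^+ 2)); last by ring.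
have : 0 <= a ^+ 8 by apply: exprn_even_ge0.
have : 0 <= b ^+ 8 by apply: exprn_even_ge0.
lra.
Qed.

(** The weights add up to 1, so for variables with equal third moments nothing is lost; this keeps
    the factor 1/2 in the cubic term of the theorem. *)
Lemma sqrM_le_cubes {R : realFieldType} (x y : R) : 0 <= x -> 0 <= y ->
  x ^+ 2 * y <= 2 / 3 * x ^+ 3 + 1 / 3 * y ^+ 3.
Proof.
move=> x0 y0.
have : 0 <= (x - y) ^+ 2 * (2 * x + y).
  by rewrite mulr_ge0 ?sqr_ge0// addr_ge0// mulr_ge0.
rewrite (_ : _ * _ = 2 * x ^+ 3 + y ^+ 3 - 3 * (x ^+ 2 * y)); last by ring.
lra.
Qed.

(** * Stein's bound with centred T_A *)

Section SteinBound.
Context {R : realType} {dT : measure_display} {T : measurableType dT} {n : nat}.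
Notation I := (nat * 'I_n)%type.
Context (Q : probability (pathspace T I) R) (iidQ : iid_copies Q).
Notation E := (Ex Q).
Implicit Types (A : {set 'I_n}) (i j k : 'I_n).
Context (f : n.-tuple T -> R) (mf : measurable_fun setT f).
Hypothesis Lf : L2 Q (fun v => f (pt (copy 0) v)).
Hypothesis iM8 : integ Q (fun v => maxDelta f (pt (copy 0) v) (pt (copy 1) v) ^+ 8).
Notation x0 v := (pt (copy 0) v).
Notation x1 v := (pt (copy 1) v).

Definition pairT A (p : n.-tuple T * n.-tuple T) : R :=
  2^-1 * \sum_j Delta f j p.1 p.2 * setDelta f A j p.1 p.2.

Lemma measurable_pairT A : measurable_fun setT (pairT A).
Proof.
apply: measurable_funM => //; apply: measurable_sum => j.
by apply: measurable_funM; [exact: measurable_Delta|exact: measurable_setDelta].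
Qed.

Lemma integ_maxDelta a b : (forall k, a k != b k) ->
  integ Q (fun v => maxDelta f (pt a v) (pt b v) ^+ 8).
Proof.
move=> ab; pose S (p : n.-tuple T * n.-tuple T) := maxDelta f p.1 p.2 ^+ 8.
exact: (integ_pair iidQ (S := S) ab).
Qed.

Lemma replace_x01 A (v : pathspace T I) : replace (x0 v) (x1 v) A =
  pt (fun k => if k \in A then 1 else 0)%N v.
Proof. by rewrite replace_pt. Qed.

Lemma replace_x10 A (v : pathspace T I) : replace (x1 v) (x0 v) A =
  pt (fun k => if k \in A then 0 else 1)%N v.
Proof. by rewrite replace_pt. Qed.

Lemma integ_maxDelta_exchange A : integ Q (fun v =>
  maxDelta f (replace (x0 v) (x1 v) A) (replace (x1 v) (x0 v) A) ^+ 8).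
Proof.
under eq_integ do rewrite replace_x01 replace_x10.
by apply: integ_maxDelta => k; case: ifP.
Qed.

Let mD j : measurable_fun setT (fun v : pathspace T I => Delta f j (x0 v) (x1 v)).
Proof. exact: (measurable_pair (measurable_Delta mf j)). Qed.

Let mB A j : measurable_fun setT (fun v : pathspace T I => setDelta f A j (x0 v) (x1 v)).
Proof. exact: (measurable_pair (measurable_setDelta mf A j)). Qed.

Lemma L2_Delta_setDelta A j : L2 Q (fun v =>
  Delta f j (x0 v) (x1 v) * setDelta f A j (x0 v) (x1 v)).
Proof.
split; first exact: measurable_funM.
apply: (integ_le _ _ (integD (integ_cst Q 1) (integD iM8 (integ_maxDelta_exchange A)))).
  by apply: measurable_funX; exact: measurable_funM.
move=> v /=; rewrite normrX normrM setDelta_norm exprMn.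
have := Delta_le_max f j (x0 v) (x1 v).
have := Delta_le_max f j (replace (x0 v) (x1 v) A) (replace (x1 v) (x0 v) A).
move: (normr_ge0 (Delta f j (x0 v) (x1 v))).
move: (normr_ge0 (Delta f j (replace (x0 v) (x1 v) A) (replace (x1 v) (x0 v) A))).
move: (`|Delta f j (x0 v) (x1 v)|) (`|Delta f j _ _|) => u w w0 u0 wM uM.
exact: sqrM_le_1D8.
Qed.

Lemma L2_pairT A : L2 Q (fun v => pairT A (x0 v, x1 v)).
Proof. by apply: L2Z; apply: L2_sum => j _; exact: L2_Delta_setDelta. Qed.

Lemma integ_Delta3 j : integ Q (fun v => `|Delta f j (x0 v) (x1 v)| ^+ 3).
Proof.
apply: (integ_le _ _ (integD (integ_cst Q 1) iM8)).
  by apply: measurable_funX; exact: measurableT_comp.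
move=> v; rewrite normrX normr_id; apply: exprn_le1D => //; exact: Delta_le_max.
Qed.

Lemma integ_setDelta3 A j : integ Q (fun v => `|setDelta f A j (x0 v) (x1 v)| ^+ 3).
Proof.
under eq_integ do rewrite setDelta_norm replace_x01 replace_x10.
pose S (p : n.-tuple T * n.-tuple T) := `|Delta f j p.1 p.2| ^+ 3.
apply: (integ_pair iidQ (S := S)) => [k|]; first by case: ifP.
exact: integ_Delta3.
Qed.

Lemma Ex_setDelta3 A j : E (fun v => `|setDelta f A j (x0 v) (x1 v)| ^+ 3) =
  E (fun v => `|Delta f j (x0 v) (x1 v)| ^+ 3).
Proof.
under eq_Ex do rewrite setDelta_norm replace_x01 replace_x10.
pose S (p : n.-tuple T * n.-tuple T) := `|Delta f j p.1 p.2| ^+ 3.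
apply: (Ex_pair iidQ (S := S)) => [|k]; last by case: ifP.
by apply: measurable_funX; apply: measurableT_comp => //; exact: measurable_Delta.
Qed.

Hypothesis n0 : (0 < n)%N.
Hypothesis Ef : E (fun v => f (x0 v)) = 0.
Hypothesis Ef2 : E (fun v => f (x0 v) ^+ 2) = 1.
Variables (psi dpsi : R -> R).
Hypotheses (mpsi : measurable_fun setT psi) (mdpsi : measurable_fun setT dpsi)
  (dpsi4 : forall x, `|dpsi x| <= 4)
  (taylor : forall x y, `|psi y - psi x - dpsi x * (y - x)| <= (y - x) ^+ 2).
Hypothesis Lpsi : L2 Q (fun v => psi (f (x0 v))).

Let Ldpsi F : L2 Q F -> L2 Q (fun v => dpsi (f (x0 v)) * F v).
Proof.
move=> LF; apply: (L2_bounded_mul (c := 4)) => //.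
by apply: (measurableT_comp mdpsi); apply: (measurableT_comp mf); exact: measurable_pt.
Qed.

Let L2_Delta (g : n.-tuple T -> R) j : L2 Q (fun v => g (x0 v)) ->
  L2 Q (fun v => Delta g j (x0 v) (x1 v)).
Proof. by move=> Lg; apply: L2B => //; exact: (L2_replace iidQ (g := g)). Qed.

Let LpsiB A j : integ Q (fun v =>
  Delta (psi \o f) j (x0 v) (x1 v) * setDelta f A j (x0 v) (x1 v)).
Proof.
by apply: L2_mul; [exact: (L2_Delta (g := psi \o f))|exact: L2_setDelta].
Qed.

Let LdB A j : integ Q (fun v => dpsi (f (x0 v)) *
  (Delta f j (x0 v) (x1 v) * setDelta f A j (x0 v) (x1 v))).
Proof. by apply/L2_integ/Ldpsi; exact: L2_Delta_setDelta. Qed.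

Let rem A j (v : pathspace T I) := dpsi (f (x0 v)) *
    (Delta f j (x0 v) (x1 v) * setDelta f A j (x0 v) (x1 v)) -
  Delta (psi \o f) j (x0 v) (x1 v) * setDelta f A j (x0 v) (x1 v).

Let remainder_le A j :
  `|E (rem A j)| <= E (fun v => `|Delta f j (x0 v) (x1 v)| ^+ 3).
Proof.
apply: (le_trans (Ex_norm (integB (LdB A j) (LpsiB A j)))).
have i3 := integZ (2 / 3) (integ_Delta3 j).
have i3' := integZ (1 / 3) (integ_setDelta3 A j).
apply: (@le_trans _ _ (E (fun v => 2 / 3 * `|Delta f j (x0 v) (x1 v)| ^+ 3 +
    1 / 3 * `|setDelta f A j (x0 v) (x1 v)| ^+ 3))).
  apply: Ex_le; [exact/integ_norm/integB|exact: integD|move=> v].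
  rewrite mulrA -mulrBl normrM.
  have := taylor (f (x0 v)) (f (replace (x0 v) (x1 v) [set j])).
  set y := f (replace _ _ _); set x := f (x0 v).
  have -> : psi y - psi x - dpsi x * (y - x) =
      dpsi x * Delta f j (x0 v) (x1 v) - Delta (psi \o f) j (x0 v) (x1 v).
    by rewrite /Delta /= -/x -/y; ring.
  have -> : (y - x) ^+ 2 = `|Delta f j (x0 v) (x1 v)| ^+ 2.
    by rewrite real_normK ?num_real// /Delta -sqrrN opprB.
  move=> le2; apply: le_trans (ler_wpM2r (normr_ge0 _) le2) _.
  exact: sqrM_le_cubes.
rewrite ExD// !ExZ//; [|exact: integ_setDelta3|exact: integ_Delta3].
by rewrite Ex_setDelta3; move: (E _) => e; lra.
Qed.

Let Ex_pairT A : E (fun v => pairT A (x0 v, x1 v)) = 2^-1 * \sum_j E (fun v =>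
  Delta f j (x0 v) (x1 v) * setDelta f A j (x0 v) (x1 v)).
Proof.
rewrite ExZ; last by apply: integ_sum => j _; exact/L2_integ/L2_Delta_setDelta.
by rewrite Ex_sum// => j _; exact/L2_integ/L2_Delta_setDelta.
Qed.

(** The identity with [g = f]: the average of E T_A is the variance 1. Hence E psi' can be written
    as an average of E T_A times E psi', which is what centres each T_A in [stein_bound]. *)
Let sum_pairT : \sum_(A : {set 'I_n}) subset_weight A * E (fun v => pairT A (x0 v, x1 v)) = 1.
Proof.
rewrite -Ef2; under [RHS]eq_Ex do rewrite expr2.
rewrite (covariance_identity iidQ Lf Ef mf Lf).
by apply: eq_bigr => A _; rewrite Ex_pairT.
Qed.

Let Idpsi : L2 Q (fun v => dpsi (f (x0 v))).
Proof.
by have := Ldpsi (L2_cst Q 1); under eq_L2 do rewrite mulr1.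
Qed.

Lemma stein_bound : `|E (fun v => dpsi (f (x0 v)) - f (x0 v) * psi (f (x0 v)))| <=
  \sum_(A : {set 'I_n}) subset_weight A *
    `|E (fun v => dpsi (f (x0 v)) * (pairT A (x0 v, x1 v) -
       E (fun v => pairT A (x0 v, x1 v))))| +
  2^-1 * \sum_j E (fun v => `|Delta f j (x0 v) (x1 v)| ^+ 3).
Proof.
have Id := L2_integ Idpsi.
rewrite ExB//; last exact: L2_mul.
under [X in _ - X]eq_Ex do rewrite mulrC.
rewrite (covariance_identity iidQ Lf Ef (g := psi \o f))//; last exact: measurableT_comp.
rewrite -[X in X - _]mul1r -[X in X * _ - _]sum_pairT mulr_suml -sumrB.
pose D3 := 2^-1 * \sum_j E (fun v => `|Delta f j (x0 v) (x1 v)| ^+ 3).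
rewrite -[X in _ + X]mul1r -[X in _ + X * _](sum_subset_weight (R := R) n0) mulr_suml
  -big_split/=.
apply: (le_trans (ler_norm_sum _ _ _)); apply: ler_sum => A _.
rewrite -mulrA -mulrBr -mulrDr normrM ger0_norm ?subset_weight_ge0//.
apply: ler_wpM2l; first exact: subset_weight_ge0.
have -> : E (fun v => dpsi (f (x0 v)) * (pairT A (x0 v, x1 v) -
       E (fun v => pairT A (x0 v, x1 v)))) =
    2^-1 * \sum_j E (fun v => dpsi (f (x0 v)) *
      (Delta f j (x0 v) (x1 v) * setDelta f A j (x0 v) (x1 v))) -
    E (fun v => pairT A (x0 v, x1 v)) * E (fun v => dpsi (f (x0 v))).
  rewrite -(ExZ _ Id) -Ex_sum; last by move=> j _; exact: LdB.
  rewrite -ExZ; last by apply: integ_sum => j _; exact: LdB.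
  rewrite -ExB; [|by apply: integZ; apply: integ_sum => j _; exact: LdB|exact: integZ].
  by apply: eq_Ex => v; rewrite /pairT/= -mulr_sumr; ring.
set a := E _ * E _; set c := (X in 2^-1 * X - a); set b := (X in a - 2^-1 * X).
have : `|2^-1 * c - 2^-1 * b| <= 2^-1 * \sum_j E (fun v => `|Delta f j (x0 v) (x1 v)| ^+ 3).
  rewrite -mulrBr normrM ger0_norm ?invr_ge0// ler_wpM2l ?invr_ge0//.
  rewrite /b /c -sumrB; apply: (le_trans (ler_norm_sum _ _ _)).
  apply: ler_sum => j _; rewrite -ExB; [exact: remainder_le|exact: LdB|exact: LpsiB].
have -> : a - 2^-1 * b = (2^-1 * c - 2^-1 * b) - (2^-1 * c - a) by ring.
move=> h; apply: (le_trans (ler_normB _ _)); rewrite addrC lerD2l; exact: h.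
Qed.

End SteinBound.

(** * Neighbours in the interaction graph *)

Section DegreeMoments.
Context {R : realType} {dT : measure_display} {T : measurableType dT} {n : nat}.
Notation I := (nat * 'I_n)%type.
Context (Q : probability (pathspace T I) R) (iidQ : iid_copies Q).
Notation E := (Ex Q).
Context (G : graphical_rule T n) (G' : graphical_rule T n.+4).
Hypotheses (symG' : symmetric_rule G') (extG : extension G G').
Implicit Types (i j k l : 'I_n) (v : pathspace T I).
Notation x0 v := (pt (copy 0) v).
Notation x1 v := (pt (copy 1) v).

Definition wide : 'I_n -> 'I_n.+4 := widen_ord (leq_addl 4 n).

Lemma wide_inj : injective wide.
Proof. by move=> j k /(congr1 val) /= jk; exact: val_inj. Qed.

Lemma measurable_edgeR m (H : graphical_rule T m) (i j : 'I_m) :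
  measurable_fun setT (fun x => (H x i j)%:R : R).
Proof.
have [->|ij] := eqVneq i j.
  rewrite (_ : (fun x => _) = cst 0); first exact: measurable_cst.
  by apply/funext => x; rewrite edge_irrefl.
rewrite (_ : (fun x => _) = \1_[set x | H x i j]).
  by apply: measurable_indic; exact: measurable_edge.
apply/funext => x; rewrite indicE; congr (_%:R); congr nat_of_bool.
by apply/idP/idP; rewrite inE.
Qed.

Lemma degreeE m (H : graphical_rule T m) x (i : 'I_m) :
  (degree (H x) i)%:R = \sum_j (H x i j)%:R :> R.
Proof.
rewrite /degree -sum1_card natr_sum big_mkcond /=.
by apply: eq_bigr => j _; rewrite inE; case: (H x i j).
Qed.

Lemma measurable_degree m (H : graphical_rule T m) (i : 'I_m) :
  measurable_fun setT (fun x => (degree (H x) i)%:R : R).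
Proof.
rewrite (_ : (fun x => _) = fun x => \sum_j (H x i j)%:R).
  by apply: measurable_sum => j; exact: measurable_edgeR.
by apply/funext => x; rewrite degreeE.
Qed.

(* The first [n] points form copy 0, the other four are fresh. *)
Definition fresh4 i (k : 'I_n.+4) : I :=
  if insub (val k) is Some j then (0%N, j) else ((3 + k)%N, i).

(* The points with index in [s], a sequence of size four, are replaced by those
   of copy 1 and moved to the last four places; a repeated entry of [s] leaves
   its place to a fresh point. *)
Definition moved i (s : seq 'I_n) (k : 'I_n.+4) : I :=
  if insub (val k) is Some j then (nat_of_bool (j \in s), j)
  else let l := nth i s (k - n) in
    if index l s == (k - n)%N then (0%N, l) else ((3 + k)%N, i).

Lemma moved_inj i s : size s = 4 -> i \notin s -> injective (moved i s).
Proof.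
move=> s4 si k k'; rewrite /moved.
have H (m : 'I_n.+4) : (n <= m)%N -> (m - n < 4)%N by have := ltn_ord m; lia.
case: insubP => [j _ jk|kn]; case: insubP => [j' _ jk'|kn'].
- by move=> [_ jj']; apply: val_inj; rewrite /= -jk -jk' jj'.
- case: ifP => [|_ []]; last by case: (j \in s).
  move=> /eqP e [] b jl; move: b.
  by rewrite jl -index_mem e s4 H// leqNgt.
- case: ifP => [|_ []]; last by case: (j' \in s).
  move=> /eqP e [] + jl.
  by rewrite -jl -index_mem e s4 H// leqNgt.
- rewrite -!leqNgt in kn kn'.
  case: ifP => [/eqP e|_]; case: ifP => [/eqP e'|_] => -[].
  + move=> ll; apply: val_inj => /=.
    have : (k - n = k' - n)%N by rewrite -e -e' ll.
    by move: kn kn' => /=; lia.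
  + by [].
  + by [].
  + by move=> kk; apply: val_inj => /=; lia.
Qed.

Lemma fresh4_inj i : injective (fresh4 i).
Proof.
move=> k k'; rewrite /fresh4.
case: insubP => [j _ jk|kn]; case: insubP => [j' _ jk'|kn'] => -[].
- by move=> jj'; apply: val_inj; rewrite /= -jk -jk' jj'.
- by [].
- by [].
- by move=> kk; apply: val_inj => /=; lia.
Qed.

Lemma edge_fresh4 i j k v : G (x0 v) j k = G' (coords (fresh4 i) v) (wide j) (wide k).
Proof.
apply: extG.2; split; first exact: wide_inj.
by move=> l; rewrite !tnth_mktuple /fresh4 /= valK.
Qed.

(** In the configuration with only [l] replaced, the other entries of [s] keep their old values,
    which [iota] finds in the last four places. The vertices [i] and [l] stay where they are, so the
    edge is read at the same two places for every [l] in [s]. *)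
Lemma edge_moved i s l v : size s = 4 -> i \notin s -> l \in s ->
  G (replace (x0 v) (x1 v) [set l]) i l = G' (coords (moved i s) v) (wide i) (wide l).
Proof.
move=> s4 si ls.
pose iota j : 'I_n.+4 := if (j == l) || (j \notin s) then wide j else inord (n + index j s).
have lt4 j : j \in s -> (n + index j s < n.+4)%N.
  by rewrite -index_mem s4; lia.
have -> : wide i = iota i by rewrite /iota si orbT.
have -> : wide l = iota l by rewrite /iota eqxx.
apply: extG.2; split.
  move=> j j'; rewrite /iota.
  case: ifPn => [_|]; last rewrite negb_or negbK => /andP[jl js].
    case: ifPn => [_ /wide_inj//|]; rewrite negb_or negbK => /andP[jl js].
    by move=> /(congr1 val); rewrite /= inordK ?lt4//; have := ltn_ord j; lia.
  case: ifPn => [_|].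
    by move=> /(congr1 val); rewrite /= inordK ?lt4//; have := ltn_ord j'; lia.
  rewrite negb_or negbK => /andP[jl' js'] /(congr1 val).
  rewrite /= !inordK ?lt4// => /addnI e.
  by rewrite -(nth_index i js) e nth_index.
move=> j; rewrite !tnth_mktuple inE /iota /moved.
case: (eqVneq j l) => [->|jl] /=; first by rewrite valK ls.
case: (boolP (j \in s)) => js /=; last by rewrite valK (negbTE js).
rewrite inordK ?lt4// insubF; last by rewrite ltnNge leq_addr.
by rewrite addKn nth_index// eqxx.
Qed.

Lemma sumR_expn4 (x : 'I_n -> R) :
  (\sum_j x j) ^+ 4 = \sum_(t : {ffun 'I_4 -> 'I_n}) \prod_m x (t m).
Proof.
rewrite -(bigA_distr_bigA (fun (_ : 'I_4) j => x j)).
by rewrite prodr_const card_ord.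
Qed.

Lemma Ex_coords m (s s' : 'I_m -> I) (F : m.-tuple T -> R) :
  injective s -> injective s' -> measurable_fun setT F ->
  E (fun v => F (coords s v)) = E (fun v => F (coords s' v)).
Proof.
move=> ins ins' mF; rewrite /Ex /Rintegral.
rewrite -(integral_coords iidQ ins ins' (f := EFin \o F))//; exact/measurable_EFinP.
Qed.

Let g i j v : R := (G' (coords (fresh4 i) v) (wide i) (wide j))%:R.

Let edge01 (b : bool) : `|b%:R| <= 1 :> R.
Proof. by case: b; rewrite ?normr1 ?normr0. Qed.

Lemma measurable_prod_edge m (H : graphical_rule T m) (a : 'I_m) (t : 'I_4 -> 'I_m) :
  measurable_fun setT (fun x => \prod_(k < 4) (H x a (t k))%:R : R).
Proof.
by apply: measurable_prod => k _; exact: measurable_edgeR.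
Qed.

Let prod_le1 (b : 'I_4 -> bool) : `|\prod_m (b m)%:R| <= 1 :> R.
Proof.
rewrite normr_prod; apply: (@le_trans _ _ (\prod_(m < 4) 1)); last by rewrite big1.
by apply: ler_prod => m _; rewrite normr_ge0 edge01.
Qed.

(** If [i] is among the four indices, both products contain a loop and vanish. Otherwise the four
    edges are read from the single sample [moved], which has the law of [fresh4]. *)
Lemma Ex_edges_moved i (t : {ffun 'I_4 -> 'I_n}) :
  E (fun v => \prod_m (G (replace (x0 v) (x1 v) [set t m]) i (t m))%:R) =
  E (fun v => \prod_m g i (t m) v).
Proof.
case: (boolP (i \in codom t)) => [/codomP[m im]|ti].
  apply: eq_Ex => v; rewrite [LHS](bigD1 m)//= [RHS](bigD1 m)//=.
  by rewrite -im /g !edge_irrefl !mul0r.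
have s4 : size (codom t) = 4 by rewrite size_codom card_ord.
under eq_Ex do under eq_bigr do rewrite (edge_moved _ s4 ti) ?codom_f//.
apply: (@Ex_coords _ (moved i (codom t)) (fresh4 i)
  (fun y => \prod_m (G' y (wide i) (wide (t m)))%:R)).
- exact: moved_inj.
- exact: fresh4_inj.
- exact: (measurable_prod_edge G' (wide i) (fun m => wide (t m))).
Qed.

(** A transposition brings vertex [i] to the first place: the symmetry of [G'] transports the degree
    and exchangeability the law. *)
Lemma Ex_degree_wide i (s : 'I_n.+4 -> I) : injective s ->
  E (fun v => (degree (G' (coords (fresh4 i) v)) (wide i))%:R ^+ 4) =
  E (fun v => (degree (G' (coords s v)) ord0)%:R ^+ 4).
Proof.
move=> ins.
have md a : measurable_fun setT (fun x => (degree (G' x) a)%:R ^+ 4 : R).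
  by apply: measurable_funX; exact: measurable_degree.
pose pi := tperm ord0 (wide i).
rewrite -(Ex_coords (s := fresh4 i \o pi) _ ins (md ord0)); last first.
  by apply: inj_comp; [exact: fresh4_inj|exact: perm_inj].
apply: eq_Ex => v; congr (_%:R ^+ 4); rewrite /degree.
have -> : coords (fresh4 i \o pi) v = [tuple tnth (coords (fresh4 i) v) (pi k) | k < n.+4].
  by apply: eq_from_tnth => k; rewrite !tnth_mktuple.
rewrite -[LHS](card_preimset _ (@perm_inj _ pi)); apply: eq_card => k.
by rewrite !inE symG' tpermL.
Qed.

Let sum_g_le i v : \sum_j g i j v <= (degree (G' (coords (fresh4 i) v)) (wide i))%:R.
Proof.
rewrite degreeE (bigID (mem (wide @: [set: 'I_n]%SET)))/= ler_wpDr ?sumr_ge0//.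
rewrite big_imset/=; last by move=> j k _ _; exact: wide_inj.
by rewrite [leRHS](eq_bigl xpredT)// => j; rewrite finset.in_setT.
Qed.

Let degree_le m (H : graphical_rule T m) x (i : 'I_m) : (degree (H x) i)%:R <= m%:R :> R.
Proof. by rewrite ler_nat -[leqRHS](card_ord m) max_card. Qed.

Lemma integ_degree m (H : graphical_rule T m) (s : 'I_m -> I) (i : 'I_m) (c : nat) :
  integ Q (fun v => (c + degree (H (coords s v)) i)%N%:R ^+ 4).
Proof.
apply: (@integ_bounded _ _ _ Q _ ((c + m)%N%:R ^+ 4)) => [|v].
  apply: measurable_funX.
  rewrite (_ : (fun v => _) = fun v => c%:R + (degree (H (coords s v)) i)%:R); last first.
    by apply/funext => v; rewrite natrD.
  apply: measurable_funD => //.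
  by apply: (measurableT_comp (measurable_degree H i)); exact: measurable_coords.
rewrite normrX ger0_norm// lerXn2r ?nnegrE// !natrD lerD2l; exact: degree_le.
Qed.

(** This absorbs additive constants into the degree moment and keeps that moment positive. *)
Lemma Ex_degree_ge1 (s : 'I_n.+4 -> I) :
  1 <= E (fun v => (1 + degree (G' (coords s v)) ord0)%N%:R ^+ 4).
Proof.
rewrite -[leLHS](Ex_cst Q); apply: Ex_le; [exact: integ_cst|exact: integ_degree|].
by move=> v; rewrite exprn_ege1// ler1n.
Qed.

Let Ex_sum_g_le i (s : 'I_n.+4 -> I) : injective s ->
  E (fun v => (\sum_j g i j v) ^+ 4) <=
  E (fun v => (1 + degree (G' (coords s v)) ord0)%N%:R ^+ 4).
Proof.
move=> ins.
have mg : measurable_fun setT (fun v => \sum_j g i j v).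
  apply: measurable_sum => j.
  by apply: (measurableT_comp (measurable_edgeR G' _ _)); exact: measurable_coords.
have g0 v : 0 <= \sum_j g i j v by apply: sumr_ge0.
apply: (@le_trans _ _ (E (fun v => (degree (G' (coords (fresh4 i) v)) (wide i))%:R ^+ 4))).
  have idg := integ_degree G' (fresh4 i) (wide i) 0.
  apply: Ex_le => // [|v]; last by rewrite lerXn2r ?nnegrE.
  apply: integ_le idg; first exact: measurable_funX.
  by move=> v; rewrite ger0_norm ?exprn_ge0// lerXn2r ?nnegrE.
rewrite (Ex_degree_wide i ins); apply: Ex_le => [||v].
- exact: (integ_degree G' s ord0 0).
- exact: integ_degree.
- by rewrite lerXn2r ?nnegrE// ler_nat leq_addl.
Qed.

(** Only the first count needs the expansion into products of four edges, since its graph depends on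
    [j]; the second is at most a degree in one extended graph. *)
Lemma Ex_neighbours_le i (s : 'I_n.+4 -> I) : injective s ->
  E (fun v => (\sum_j (G (replace (x0 v) (x1 v) [set j]) i j)%:R) ^+ 4) <=
    E (fun v => (1 + degree (G' (coords s v)) ord0)%N%:R ^+ 4) /\
  E (fun v => (\sum_j (G (x0 v) i j)%:R) ^+ 4) <=
    E (fun v => (1 + degree (G' (coords s v)) ord0)%N%:R ^+ 4).
Proof.
move=> ins; split; last first.
  under eq_Ex do under eq_bigr do rewrite (edge_fresh4 i).
  exact: Ex_sum_g_le.
apply: le_trans (Ex_sum_g_le i ins).
pose V (t : {ffun 'I_4 -> 'I_n}) v : R :=
  \prod_m (G (replace (x0 v) (x1 v) [set t m]) i (t m))%:R.
pose V' (t : {ffun 'I_4 -> 'I_n}) v : R := \prod_(m < 4) g i (t m) v.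
have m1 (t : {ffun 'I_4 -> 'I_n}) : integ Q (V t).
  apply: (@integ_bounded _ _ _ Q _ 1) => [|v]; last exact: prod_le1.
  apply: measurable_prod => m _.
  have mr := @measurable_replace _ T n [set t m]%SET.
  exact: (measurable_pair (measurableT_comp (measurable_edgeR G i (t m)) mr)).
have m2 (t : {ffun 'I_4 -> 'I_n}) : integ Q (V' t).
  apply: (@integ_bounded _ _ _ Q _ 1) => [|v]; last exact: prod_le1.
  apply: measurable_prod => m _.
  by apply: (measurableT_comp (measurable_edgeR G' _ _)); exact: measurable_coords.
rewrite le_eqVlt; apply/orP; left; apply/eqP.
transitivity (E (fun v => \sum_(t : {ffun 'I_4 -> 'I_n}) V t v)).
  by apply: eq_Ex => v; rewrite sumR_expn4.
transitivity (E (fun v => \sum_(t : {ffun 'I_4 -> 'I_n}) V' t v)); last first.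
  by apply: eq_Ex => v; rewrite sumR_expn4.
rewrite !Ex_sum; [|by move=> t _; exact: m2|by move=> t _; exact: m1].
by apply: eq_bigr => t _; exact: Ex_edges_moved.
Qed.

End DegreeMoments.

Lemma expr4D_le {R : realDomainType} (p q : R) :
  (p + q) ^+ 4 <= 8 * (p ^+ 4 + q ^+ 4).
Proof.
rewrite -subr_ge0 (_ : _ - _ =
  (p - q) ^+ 2 * (5 * (p + q) ^+ 2 + 2 * p ^+ 2 + 2 * q ^+ 2)); last by ring.
by rewrite mulr_ge0 ?sqr_ge0// !addr_ge0// mulr_ge0 ?sqr_ge0.
Qed.

Lemma expr4M_le {R : realFieldType} (p q : R) :
  (p * q) ^+ 4 <= 2^-1 * (p ^+ 8 + q ^+ 8).
Proof.
have := sqr_ge0 (p ^+ 4 - q ^+ 4).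
rewrite (_ : (_ - _) ^+ 2 = p ^+ 8 + q ^+ 8 - 2 * (p * q) ^+ 4); last by ring.
lra.
Qed.

(** * Effect of resampling one coordinate *)

Section Interaction.
Context {R : realType} {dT : measure_display} {T : measurableType dT} {n : nat}.
Context (f : n.-tuple T -> R) (G : graphical_rule T n).
Hypothesis ruleG : interaction_rule f G.
Implicit Types (A : {set 'I_n}) (i j k : 'I_n) (x z : n.-tuple T).

Lemma Delta_noninteracting x x' z i j : i != j ->
  let y := replace x z [set i] in
  ~~ [|| G x i j, G (replace x x' [set j]) i j, G y i j | G (replace y x' [set j]) i j] ->
  Delta f j x x' = Delta f j y x'.
Proof.
move=> ij y; rewrite !negb_or => /and4P[e1 e2 e3 e4].
(* The interaction rule takes all replacements from one point; [x''] supplies [z] at [i] and [x'] at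
   [j]. *)
pose x'' := replace x' z [set i].
have E1 : replace x x'' [set i] = y.
  apply: eq_from_tnth => k; rewrite !tnth_mktuple inE.
  by case: eqVneq.
have E2 : replace x x'' [set j] = replace x x' [set j].
  apply: eq_from_tnth => k; rewrite !tnth_mktuple !inE.
  by case: (eqVneq k j) => // ->; rewrite eq_sym (negbTE ij).
have E3 : replace x x'' [set i; j] = replace y x' [set j].
  apply: eq_from_tnth => k; rewrite !tnth_mktuple !inE.
  case: (eqVneq k i) => [->|ki]; first by rewrite /= (negbTE ij).
  by case: (eqVneq k j).
have := @ruleG x x'' i j ij e1; rewrite E1 E2 E3 => /(_ e3 e2 e4).
by rewrite /noninteracting E1 E2 E3.
Qed.

Lemma replace_exchange_set1 A x x' z i : i \notin A ->
  replace (replace x z [set i]) x' A = replace (replace x x' A) z [set i] /\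
  replace x' (replace x z [set i]) A = replace x' x A.
Proof.
move=> iA; split; apply: eq_from_tnth => k; rewrite !tnth_mktuple inE.
  by case: (eqVneq k i) => // ->; rewrite (negbTE iA).
by case: (eqVneq k i) => // ->; rewrite (negbTE iA).
Qed.

(** If [i] is in [A], both configurations read coordinate [i] from [x'] and do not see the change.
    Otherwise the change passes to the exchanged pair, where [Delta_noninteracting] applies. *)
Lemma setDelta_noninteracting A x x' z i j : i != j ->
  let y := replace x z [set i] in
  let u := replace x x' A in let u' := replace x' x A in
  let w := replace y x' A in let w' := replace x' y A in
  ~~ [|| G u i j, G (replace u u' [set j]) i j, G w i j | G (replace w w' [set j]) i j] ->
  setDelta f A j x x' = setDelta f A j y x'.
Proof.
move=> ij y u u' w w' noedge; case: (boolP (i \in A)) => iA.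
  rewrite /setDelta; congr (f _ - f _); apply: eq_from_tnth => k;
    rewrite !tnth_mktuple !inE; case: (eqVneq k i) => // ->.
    by rewrite ij iA.
  by rewrite iA orbT.
have [wE w'E] := replace_exchange_set1 x x' z iA.
move: noedge; rewrite !setDeltaE -/u -/u' -/y -/w -/w' {}/w' {}/w w'E wE => noedge.
by rewrite (Delta_noninteracting ij noedge).
Qed.

Definition edges_at (q : n.-tuple T * n.-tuple T) i j : nat :=
  G q.1 i j + G (replace q.1 q.2 [set j]) i j.

(** A summand [j] can change only if [j = i] or one of the eight possible edges is present, and then
    by at most the last factor. The counting factor sums these indicators over [j]; its 1 is the
    term [j = i]. *)
Lemma pairT_diff_le A x x' z i y u u' w w' : y = replace x z [set i] ->
  u = replace x x' A -> u' = replace x' x A ->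
  w = replace y x' A -> w' = replace x' y A ->
  `|pairT f A (x, x') - pairT f A (y, x')| <=
  2^-1 * ((1 + ((\sum_j (edges_at (x, x') i j)%:R + \sum_j (edges_at (y, x') i j)%:R) +
     (\sum_j (edges_at (u, u') i j)%:R + \sum_j (edges_at (w, w') i j)%:R))) *
  (maxDelta f x x' * maxDelta f u u' + maxDelta f y x' * maxDelta f w w')).
Proof.
move=> yE uE u'E wE w'E.
rewrite /pairT -mulrBr normrM ger0_norm ?invr_ge0// ler_pM2l ?invr_gt0//.
have one : 1 = \sum_j (j == i)%:R :> R.
  rewrite (bigD1 i)//= eqxx big1 ?addr0// => j /negbTE ->//.
rewrite [X in _ <= (X + _) * _]one -!big_split/= mulr_suml -sumrB
  (le_trans (ler_norm_sum _ _ _))//.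
apply: ler_sum => j _; set K := (X in _ <= _ * X).
have b1 : `|Delta f j x x' * setDelta f A j x x'| <= maxDelta f x x' * maxDelta f u u'.
  by rewrite normrM setDelta_norm -uE -u'E ler_pM// Delta_le_max.
have b2 : `|Delta f j y x' * setDelta f A j y x'| <= maxDelta f y x' * maxDelta f w w'.
  by rewrite normrM setDelta_norm -wE -w'E ler_pM// Delta_le_max.
have K0 : 0 <= K by rewrite /K addr_ge0// mulr_ge0// maxDelta_ge0.
have [ij|ij] := eqVneq j i.
  rewrite (le_trans (ler_normB _ _))// (le_trans (lerD b1 b2))// -/K.
  by rewrite ler_peMl//= mulr1n lerDl !addr_ge0.
case: (boolP [|| G x i j, G (replace x x' [set j]) i j, G y i j |
    G (replace y x' [set j]) i j]) => e1.
  rewrite (le_trans (ler_normB _ _))// (le_trans (lerD b1 b2))// -/K ler_peMl//= mulr0n add0r.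
  rewrite ler_wpDr ?addr_ge0// -natrD ler1n /edges_at/=.
  by move: e1; do 4 case: (G _ _ _).
case: (boolP [|| G u i j, G (replace u u' [set j]) i j, G w i j |
    G (replace w w' [set j]) i j]) => e2.
  rewrite (le_trans (ler_normB _ _))// (le_trans (lerD b1 b2))// -/K ler_peMl//= mulr0n add0r.
  rewrite ler_wpDl ?addr_ge0// -natrD ler1n /edges_at/=.
  by move: e2; do 4 case: (G _ _ _).
rewrite eq_sym in ij.
rewrite yE in e1; rewrite uE u'E wE w'E yE in e2.
rewrite (Delta_noninteracting ij e1) (setDelta_noninteracting ij e2) -yE subrr normr0.
by rewrite mulr_ge0// !addr_ge0.
Qed.

End Interaction.

(** Three nested uses of [expr4D_le], whence [512 = 8 ^ 3]. *)
Lemma expr4_sum_le {R : realFieldType} (e1 e2 e3 e4 : R) :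
  (1 + ((e1 + e2) + (e3 + e4))) ^+ 4 <=
  8 + 512 * ((e1 ^+ 4 + e2 ^+ 4) + (e3 ^+ 4 + e4 ^+ 4)).
Proof.
have lin (t s p q a b c d : R) : t <= 8 * (1 + s) -> s <= 8 * (p + q) ->
    p <= 8 * (a + b) -> q <= 8 * (c + d) -> t <= 8 + 512 * ((a + b) + (c + d)).
  by lra.
have := expr4D_le 1 ((e1 + e2) + (e3 + e4)); rewrite expr1n => H.
exact: (lin _ _ _ _ _ _ _ _ H (expr4D_le _ _) (expr4D_le _ _) (expr4D_le _ _)).
Qed.

Lemma expr4_sumM_le {R : realFieldType} (e1 e2 e3 e4 : R) :
  (e1 * e2 + e3 * e4) ^+ 4 <= 4 * ((e1 ^+ 8 + e2 ^+ 8) + (e3 ^+ 8 + e4 ^+ 8)).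
Proof.
have lin (t p q a b c d : R) : t <= 8 * (p + q) -> p <= 2^-1 * (a + b) ->
    q <= 2^-1 * (c + d) -> t <= 4 * ((a + b) + (c + d)).
  by lra.
exact: (lin _ _ _ _ _ _ _ (expr4D_le _ _) (expr4M_le _ _) (expr4M_le _ _)).
Qed.

Lemma le_mul_sqrt {R : rcfType} (x a y : R) : 0 <= a -> 0 <= y ->
  x ^+ 2 <= a ^+ 2 * y -> x <= a * Num.sqrt y.
Proof.
move=> a0 y0 xay; rewrite (le_trans (ler_norm x))//.
rewrite -(ler_pXn2r (n := 2)) ?nnegrE ?mulr_ge0 ?sqrtr_ge0//.
by rewrite real_normK ?num_real// exprMn sqr_sqrtr.
Qed.

(** [8 + 512 * 64 = 32776] is rounded up to [200 ^ 2], so that the square root taken later is an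
    integer. *)
Lemma sum4_moment_le {R : realFieldType} (a1 a2 a3 a4 d : R) :
  a1 <= 16 * d -> a2 <= 16 * d -> a3 <= 16 * d -> a4 <= 16 * d -> 1 <= d ->
  8 + 512 * ((a1 + a2) + (a3 + a4)) <= 200 * (200 * d).
Proof. lra. Qed.

(** * Second moments of the Efron-Stein differences *)

Section VarianceBound.
Context {R : realType} {dT : measure_display} {T : measurableType dT} {n : nat}.
Notation I := (nat * 'I_n)%type.
Context (Q : probability (pathspace T I) R) (iidQ : iid_copies Q).
Notation E := (Ex Q).
Context (f : n.-tuple T -> R) (mf : measurable_fun setT f).
Context (G : graphical_rule T n) (G' : graphical_rule T n.+4).
Hypotheses (ruleG : interaction_rule f G) (symG' : symmetric_rule G')
  (extG : extension G G').
Notation x0 v := (pt (copy 0) v).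
Notation x1 v := (pt (copy 1) v).
Hypothesis iM8 : integ Q (fun v => maxDelta f (x0 v) (x1 v) ^+ 8).
Variables (s : 'I_n.+4 -> I) (ins : injective s).
Implicit Types (A : {set 'I_n}) (i j k : 'I_n) (v : pathspace T I).

Let m8 := E (fun v => maxDelta f (x0 v) (x1 v) ^+ 8).
Let d4 : R := E (fun v => (1 + degree (G' (coords s v)) ord0)%N%:R ^+ 4).

Let sumE i (p : n.-tuple T * n.-tuple T) : R := \sum_j (edges_at G p i j)%:R.

Let sumE_E i p : sumE i p = \sum_j (G p.1 i j)%:R +
  \sum_j (G (replace p.1 p.2 [set j]) i j)%:R.
Proof. by rewrite /sumE -big_split; apply: eq_bigr => j _; rewrite /edges_at natrD. Qed.

Let sumE_ge0 i p : 0 <= sumE i p.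
Proof. exact: sumr_ge0. Qed.

Let mG1 i : measurable_fun setT
  (fun p : n.-tuple T * n.-tuple T => \sum_j (G p.1 i j)%:R : R).
Proof.
apply: measurable_sum => j.
exact: (measurableT_comp (measurable_edgeR G i j) (measurable_fst)).
Qed.

Let mG2 i : measurable_fun setT (fun p : n.-tuple T * n.-tuple T =>
  \sum_j (G (replace p.1 p.2 [set j]) i j)%:R : R).
Proof.
apply: measurable_sum => j.
exact: (measurableT_comp (measurable_edgeR G i j) (@measurable_replace _ T n [set j]%SET)).
Qed.

Let msumE i : measurable_fun setT (sumE i).
Proof.
rewrite (_ : sumE i = fun p => \sum_j (G p.1 i j)%:R +
  \sum_j (G (replace p.1 p.2 [set j]) i j)%:R); last first.
  by apply/funext => p; rewrite sumE_E.
by apply: measurable_funD; [exact: mG1|exact: mG2].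
Qed.

Let sum_edges_le (a : 'I_n -> bool) : \sum_j (a j)%:R <= n%:R :> R.
Proof.
rewrite -natr_sum ler_nat -[leqRHS](card_ord n) -sum1_card leq_sum// => j _.
by case: (a j).
Qed.

Let integ_edges4 (F : n.-tuple T * n.-tuple T -> R) : measurable_fun setT F ->
  (forall p, 0 <= F p <= n%:R) -> integ Q (fun v => F (x0 v, x1 v) ^+ 4).
Proof.
move=> mF Fn; apply: (@integ_bounded _ _ _ Q _ (n%:R ^+ 4)) => [|v].
  by apply: measurable_funX; exact: measurable_pair.
have /andP[F0 Fle] := Fn (x0 v, x1 v).
by rewrite normrX ger0_norm// lerXn2r ?nnegrE.
Qed.

Let i1 i : integ Q (fun v => (\sum_j (G (x0 v) i j)%:R) ^+ 4).
Proof.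
apply: (integ_edges4 (mG1 i)) => p; rewrite sumr_ge0//=; exact: sum_edges_le.
Qed.

Let i2 i : integ Q (fun v => (\sum_j (G (replace (x0 v) (x1 v) [set j]) i j)%:R) ^+ 4).
Proof.
apply: (integ_edges4 (mG2 i)) => p; rewrite sumr_ge0//=; exact: sum_edges_le.
Qed.

(** Every pair reduces to (X, X'); there the count is a sum of two, each with fourth moment at most
    [d4], and [8 * (1 + 1) = 16]. *)
Let sumE4 i (a b : 'I_n -> nat) : (forall k, a k != b k) ->
  integ Q (fun v => sumE i (pt a v, pt b v) ^+ 4) /\
  E (fun v => sumE i (pt a v, pt b v) ^+ 4) <= 16 * d4.
Proof.
move=> ab; pose S p := sumE i p ^+ 4.
have mS : measurable_fun setT S by exact: measurable_funX.
have le8 v : S (x0 v, x1 v) <= 8 * ((\sum_j (G (x0 v) i j)%:R) ^+ 4 +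
    (\sum_j (G (replace (x0 v) (x1 v) [set j]) i j)%:R) ^+ 4).
  by rewrite /S sumE_E; exact: expr4D_le.
have i8 := integZ 8 (integD (i1 i) (i2 i)).
have iS : integ Q (fun v => S (x0 v, x1 v)).
  apply: (integ_le _ _ i8); first exact: measurable_pair.
  by move=> v; rewrite ger0_norm// exprn_ge0.
split; first exact: (integ_pair iidQ (S := S) ab).
rewrite (Ex_pair iidQ mS ab).
apply: (le_trans (Ex_le iS i8 le8)).
rewrite ExZ; last exact: integD.
rewrite ExD//; have [+ +] := Ex_neighbours_le iidQ symG' extG i ins.
rewrite -/d4; lra.
Qed.

Let d4_ge1 : 1 <= d4 := Ex_degree_ge1 Q G' s.

Let m8_ge0 : 0 <= m8.
Proof. by apply: Ex_ge0 => v; rewrite exprn_ge0// maxDelta_ge0. Qed.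

Let maxD8 (a b : 'I_n -> nat) : (forall k, a k != b k) ->
  integ Q (fun v => maxDelta f (pt a v) (pt b v) ^+ 8) /\
  E (fun v => maxDelta f (pt a v) (pt b v) ^+ 8) = m8.
Proof.
move=> ab; split; first exact: integ_maxDelta.
pose S (p : n.-tuple T * n.-tuple T) := maxDelta f p.1 p.2 ^+ 8.
apply: (Ex_pair iidQ (S := S) _ ab).
by apply: measurable_funX; exact: measurable_maxDelta.
Qed.

(** The difference is at most half the product of a neighbour count [N] and a quantity [K] quadratic
    in the maximal increments. Cauchy-Schwarz leaves their fourth moments, and all four pairs
    involved have the law of (X, X'). *)
Lemma Ex_pairT_diff_le A i : E (fun v => (pairT f A (x0 v, x1 v) -
    pairT f A (pt (fun k => if k == i then 2 else 0)%N v, x1 v)) ^+ 2) <=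
  200 * Num.sqrt (m8 * d4).
Proof.
pose Y k : nat := if k == i then 2 else 0.
pose sel (a b : 'I_n -> nat) k : nat := if k \in A then b k else a k.
have Y1 k : Y k != copy 1 k by rewrite /Y; case: ifP.
have c01 k : copy 0 k != copy 1 k by [].
have u01 k : sel (copy 0) (copy 1) k != sel (copy 1) (copy 0) k by rewrite /sel; case: ifP.
have wY k : sel Y (copy 1) k != sel (copy 1) Y k.
  by rewrite /sel; case: ifP => // _; rewrite eq_sym.
pose N v := 1 + ((sumE i (x0 v, x1 v) + sumE i (pt Y v, x1 v)) +
  (sumE i (pt (sel (copy 0) (copy 1)) v, pt (sel (copy 1) (copy 0)) v) +
   sumE i (pt (sel Y (copy 1)) v, pt (sel (copy 1) Y) v))).
pose M a b v := maxDelta f (pt a v) (pt b v).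
pose K v := M (copy 0) (copy 1) v * M (sel (copy 0) (copy 1)) (sel (copy 1) (copy 0)) v +
  M Y (copy 1) v * M (sel Y (copy 1)) (sel (copy 1) Y) v.
have bound v : `|pairT f A (x0 v, x1 v) - pairT f A (pt Y v, x1 v)| <= 2^-1 * (N v * K v).
  apply: (@pairT_diff_le _ _ _ _ f G ruleG A _ _ (pt (copy 2) v) i);
    rewrite ?replace_pt//; apply: pt_eq => k; by rewrite inE.
have mM a b : measurable_fun setT (M a b).
  exact: (measurable_pair (measurable_maxDelta mf)).
have me a b : measurable_fun setT (fun v => sumE i (pt a v, pt b v)).
  exact: (measurable_pair (msumE i)).
have mN : measurable_fun setT N.
  by do ?[apply: measurable_funD|exact: me|exact: measurable_cst].
have mK : measurable_fun setT K.
  by do ?[apply: measurable_funD|apply: measurable_funM|exact: mM].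
have [ie1 Ee1] := sumE4 i c01.
have [ie2 Ee2] := sumE4 i Y1.
have [ie3 Ee3] := sumE4 i u01.
have [ie4 Ee4] := sumE4 i wY.
have [iM1 EM1] := maxD8 c01.
have [iM2 EM2] := maxD8 Y1.
have [iM3 EM3] := maxD8 u01.
have [iM4 EM4] := maxD8 wY.
pose bN v : R := 8 + 512 * ((sumE i (x0 v, x1 v) ^+ 4 + sumE i (pt Y v, x1 v) ^+ 4) +
  (sumE i (pt (sel (copy 0) (copy 1)) v, pt (sel (copy 1) (copy 0)) v) ^+ 4 +
   sumE i (pt (sel Y (copy 1)) v, pt (sel (copy 1) Y) v) ^+ 4)).
pose bK v := 4 * ((M (copy 0) (copy 1) v ^+ 8 +
    M (sel (copy 0) (copy 1)) (sel (copy 1) (copy 0)) v ^+ 8) +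
  (M Y (copy 1) v ^+ 8 + M (sel Y (copy 1)) (sel (copy 1) Y) v ^+ 8)).
have NbN v : (N v ^+ 2) ^+ 2 <= bN v by rewrite -exprM; exact: expr4_sum_le.
have KbK v : (K v ^+ 2) ^+ 2 <= bK v by rewrite -exprM; exact: expr4_sumM_le.
have ibe := integD (integD ie1 ie2) (integD ie3 ie4).
have ibN : integ Q bN by apply: integD; [exact: (integ_cst Q 8)|exact: integZ].
have ibM := integD (integD iM1 iM3) (integD iM2 iM4).
have ibK : integ Q bK by exact: integZ.
have EbN : E bN <= 200 * (200 * d4).
  rewrite /bN (ExD (integ_cst Q 8) (integZ 512 ibe)) (ExZ _ ibe) (Ex_cst Q 8).
  rewrite (ExD (integD ie1 ie2) (integD ie3 ie4)) (ExD ie1 ie2) (ExD ie3 ie4).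
  exact: sum4_moment_le.
have EbK : E bK = 16 * m8.
  rewrite /bK (ExZ _ ibM) (ExD (integD iM1 iM3) (integD iM2 iM4)) (ExD iM1 iM3).
  by rewrite (ExD iM2 iM4) EM1 EM2 EM3 EM4; ring.
have LN : L2 Q (fun v => N v ^+ 2).
  split; first exact: measurable_funX.
  apply: (integ_le _ _ ibN); first by do 2 apply: measurable_funX.
  by move=> v; rewrite ger0_norm ?sqr_ge0.
have LK : L2 Q (fun v => K v ^+ 2).
  split; first exact: measurable_funX.
  apply: (integ_le _ _ ibK); first by do 2 apply: measurable_funX.
  by move=> v; rewrite ger0_norm ?sqr_ge0.
(* [800 ^ 2 = 200 ^ 2 * 16], the product of the constants in [EbN] and [EbK]; the square of the
   factor 1/2 later reduces 800 to 200. *)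
have cs : E (fun v => N v ^+ 2 * K v ^+ 2) <= 800 * Num.sqrt (m8 * d4).
  have d0 : 0 <= d4 by exact: le_trans d4_ge1.
  apply: le_mul_sqrt; [exact: ler0n|exact: mulr_ge0|].
  apply: (le_trans (cauchy_schwarz LN LK)).
  have -> : 800 ^+ 2 * (m8 * d4) = (200 * (200 * d4)) * (16 * m8) by ring.
  apply: ler_pM.
  - by apply: Ex_ge0 => v; rewrite sqr_ge0.
  - by apply: Ex_ge0 => v; rewrite sqr_ge0.
  - exact: (le_trans (Ex_le LN.2 ibN NbN)).
  - rewrite -EbK; exact: (Ex_le LK.2 ibK KbK).
have iNK := L2_mul LN LK.
have sq v : (pairT f A (x0 v, x1 v) - pairT f A (pt Y v, x1 v)) ^+ 2 <=
    4^-1 * (N v ^+ 2 * K v ^+ 2).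
  rewrite -[leLHS]real_normK ?num_real//.
  have -> : 4^-1 * (N v ^+ 2 * K v ^+ 2) = (2^-1 * (N v * K v)) ^+ 2 by field.
  by rewrite lerXn2r ?nnegrE// ?(le_trans _ (bound v)).
have iD : integ Q (fun v => (pairT f A (x0 v, x1 v) - pairT f A (pt Y v, x1 v)) ^+ 2).
  apply: (integ_le _ _ (integZ 4^-1 iNK)) => [|v].
    apply: measurable_funX; apply: measurable_funB;
      exact: (measurable_pair (measurable_pairT mf A)).
  by rewrite ger0_norm ?sqr_ge0.
apply: (le_trans (Ex_le iD (integZ 4^-1 iNK) sq)).
rewrite ExZ// ler_pdivrMl//; apply: (le_trans cs).
by rewrite mulrA le_eqVlt -natrM eqxx.
Qed.

End VarianceBound.

(** * The normal approximation bound *)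

Section NormalizedBound.
Context {R : realType} {dT : measure_display} {T : measurableType dT} {n : nat}.
Notation I := (nat * 'I_n)%type.
Context (Q : probability (pathspace T I) R) (iidQ : iid_copies Q).
Notation E := (Ex Q).
Context (f : n.-tuple T -> R) (mf : measurable_fun setT f).
Context (G : graphical_rule T n) (G' : graphical_rule T n.+4).
Hypotheses (n0 : (0 < n)%N) (ruleG : interaction_rule f G)
  (symG' : symmetric_rule G') (extG : extension G G').
Notation x0 v := (pt (copy 0) v).
Notation x1 v := (pt (copy 1) v).
Hypothesis iM8 : integ Q (fun v => maxDelta f (x0 v) (x1 v) ^+ 8).
Hypothesis Lf : L2 Q (fun v => f (x0 v)).
Hypothesis Ef : E (fun v => f (x0 v)) = 0.
Hypothesis Ef2 : E (fun v => f (x0 v) ^+ 2) = 1.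
Variables (s : 'I_n.+4 -> I) (ins : injective s).
Implicit Types (A : {set 'I_n}) (i j k : 'I_n) (v : pathspace T I).

Let m8 := E (fun v => maxDelta f (x0 v) (x1 v) ^+ 8).
Let d4 : R := E (fun v => (1 + degree (G' (coords s v)) ord0)%N%:R ^+ 4).

(** The [n] Efron-Stein terms have a common bound, which yields the factor [n] under the root; the
    bound does not depend on [A], so the weights can be summed out afterwards. *)
Lemma pairT_covariance_le A (phi : R -> R) : measurable_fun setT phi ->
  (forall x, `|phi x| <= 4) ->
  `|E (fun v => phi (f (x0 v)) * (pairT f A (x0 v, x1 v) -
       E (fun v => pairT f A (x0 v, x1 v))))| <=
  40 * Num.sqrt (n%:R * Num.sqrt (m8 * d4)).
Proof.
move=> mphi phi4.
apply: le_mul_sqrt; [exact: ler0n|by rewrite mulr_ge0// sqrtr_ge0|].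
rewrite real_normK ?num_real//.
have := @bounded_covariance_sq_le _ _ _ _ _ iidQ (pairT f A) (phi \o f) 4
  (measurable_pairT mf A) (measurableT_comp mphi mf) (fun x => phi4 (f x))
  (L2_pairT iidQ mf iM8 A).
move=> /le_trans; apply.
have -> : 40 ^+ 2 * (n%:R * Num.sqrt (m8 * d4)) =
    4 ^+ 2 * (2^-1 * (200 * Num.sqrt (m8 * d4) *+ n)) :> R.
  by rewrite -[in RHS]mulr_natl; field.
rewrite ler_wpM2l ?exprn_ge0// ler_wpM2l ?invr_ge0//.
rewrite -[in leRHS](card_ord n) -sumr_const; apply: ler_sum => i _.
exact: (Ex_pairT_diff_le iidQ mf ruleG symG' extG iM8 ins A i).
Qed.

Lemma lipschitz_test_le (h : R -> R) : (forall x y, `|h x - h y| <= `|x - y|) ->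
  integ Q (fun v => h (f (x0 v))) /\
  `|E (fun v => h (f (x0 v))) - \int[lebesgue_measure]_t (h t * gauss t)| <=
  40 * Num.sqrt (n%:R * Num.sqrt (m8 * d4)) +
  2^-1 * \sum_j E (fun v => `|Delta f j (x0 v) (x1 v)| ^+ 3).
Proof.
move=> hL; have [psi [dpsi [dpsiP steinE dpsi4 dpsiL]]] := stein_solution hL.
have ch : continuous h by exact: lipschitz_continuous.
have cpsi : continuous psi by exact: is_derive_continuous dpsiP.
set c := \int[_]_t _ in steinE *.
have dpsiE : dpsi = (fun x => x * psi x + (h x - c)).
  by apply/funext => x; rewrite -steinE addrC subrK.
have mpsi : measurable_fun setT psi by exact: continuous_measurable_fun.
have mh : measurable_fun setT h by exact: continuous_measurable_fun.
have mdpsi : measurable_fun setT dpsi.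
  rewrite dpsiE; apply: measurable_funD; first exact: measurable_funM.
  exact: measurable_funB.
have mfx : measurable_fun setT (fun v : pathspace T I => f (x0 v)) := Lf.1.
(* A Lipschitz function grows at most linearly, so composing it with [f] preserves square
   integrability. *)
have Lcomp (g : R -> R) (k : R) : measurable_fun setT g ->
    (forall x y, `|g x - g y| <= k * `|x - y|) -> L2 Q (fun v => g (f (x0 v))).
  move=> mg gk; have Labs : L2 Q (fun v => `|g 0| + k * `|f (x0 v)|).
    apply: L2D; first exact: (L2_cst Q `|g 0|).
    apply: L2Z; apply: L2_le Lf; first exact: measurableT_comp.
    by move=> v; rewrite normr_id.
  apply: L2_le Labs; first exact: measurableT_comp.
  move=> v; rewrite (le_trans _ (ler_norm _))//.
  have := gk (f (x0 v)) 0; rewrite subr0 => /(le_trans (lerB_dist _ _)); lra.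
have Lh : L2 Q (fun v => h (f (x0 v))).
  by apply: (Lcomp h 1) => // x y; rewrite mul1r.
have Lpsi : L2 Q (fun v => psi (f (x0 v))).
  by apply: (Lcomp psi 4) => //; exact: lipschitz_derive.
split; first exact: L2_integ.
have -> : E (fun v => h (f (x0 v))) - c =
    E (fun v => dpsi (f (x0 v)) - f (x0 v) * psi (f (x0 v))).
  rewrite -{1}(Ex_cst Q c) -ExB; [|exact: L2_integ|exact: integ_cst].
  by apply: eq_Ex => v; rewrite steinE.
have taylor := taylor_lipschitz_derive dpsiP dpsiL.
apply: (le_trans (stein_bound iidQ mf Lf iM8 n0 Ef Ef2 mpsi mdpsi dpsi4 taylor Lpsi)).
rewrite lerD2r -[leRHS]mul1r -[X in X * _](sum_subset_weight (R := R) n0) mulr_suml.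
apply: ler_sum => A _; rewrite ler_wpM2l ?subset_weight_ge0//.
exact: pairT_covariance_le.
Qed.

End NormalizedBound.

(** * Transfer from the space of copies to the given variables *)

Section Transfer.
Context {R : realType} {dT : measure_display} {T : measurableType dT}
  {d : measure_display} {Omega : measurableType d} (P : probability Omega R)
  (X : nat -> {RV P >-> T}) (iidX : iid X) (n : nat).
Notation I := (nat * 'I_n)%type.
Local Open Scope ereal_scope.

(** Copy [c] is the block of [n] consecutive terms of the sequence starting at [c * n]. *)
Definition place (ck : I) : nat := (ck.1 * n + ck.2)%N.

Lemma place_inj : injective place.
Proof.
move=> [c k] [c' k'] /= e; have kn := ltn_ord k; have kn' := ltn_ord k'.
have n0 : (0 < n)%N by exact: leq_ltn_trans kn.
have ck m (j : 'I_n) : ((m * n + j) %/ n = m)%N.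
  by rewrite divnMDl// divn_small// addn0.
have cc : c = c' by rewrite -(ck c k) -(ck c' k'); rewrite /place/= in e; rewrite e.
move: e; rewrite /place/= cc => /addnI kk; congr (_, _); exact: val_inj.
Qed.

Notation Q := (law X place).

Lemma integral_sample m (s : 'I_m -> I) (f : m.-tuple T -> \bar R) :
  injective s -> measurable_fun setT f ->
  \int[P]_w f (sample m X w) = \int[Q]_v f (coords s v).
Proof.
move=> ins mf.
have mfc (J : choiceType) (r : 'I_m -> J) :
    measurable_fun setT (fun v : pathspace T J => f (coords r v)).
  by apply: (measurableT_comp mf); exact: measurable_coords.
have iv : injective (fun k : 'I_m => val k) by exact: val_inj.
rewrite -[RHS]/(\int[Q]_v (fun u => f (coords id u)) (shift s v)).
rewrite (integral_shift iidX place_inj iv ins (mfc _ id)).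
rewrite integral_distribution_measurable; last exact: mfc.
by apply: eq_integral.
Qed.

Lemma law_iid_copies : iid_copies Q.
Proof.
split.
- move=> r f ir mf; exact: (integral_shift iidX place_inj place_inj ir mf).
- move=> r1 r2 F G ir1 ir2 dr iF iG.
  exact: (Ex_mul_block iidX place_inj ir1 ir2 place_inj place_inj dr iF iG).
- move=> m s s' f ins ins' mf.
  by rewrite -(integral_sample ins mf) -(integral_sample ins' mf).
Qed.

Variable X' : {RV P >-> n.-tuple T}.
Hypothesis copyX' : independent_copy (sample n X) X'.

Let pairP (w : Omega) : n.-tuple T * n.-tuple T := (sample n X w, X' w).
Let mpairP : measurable_fun setT pairP.
Proof. by apply: measurable_fun_pair; exact: measurable_funP. Qed.
HB.instance Definition _ := isMeasurableFun.Build _ _ _ _ pairP mpairP.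

Let pairQ (v : pathspace T I) : n.-tuple T * n.-tuple T := (pt (copy 0) v, pt (copy 1) v).
Let mpairQ : measurable_fun setT pairQ.
Proof. by apply: measurable_fun_pair; exact: measurable_pt. Qed.
HB.instance Definition _ := isMeasurableFun.Build _ _ _ _ pairQ mpairQ.

Let nu := distribution P (sample n X).

(** [X'] is a given copy, with unspecified dependence on the terms after the first [n]. Only its
    joint law with the sample enters, and this is the product law, as for copies 0 and 1. *)
Lemma integral_pair (f : n.-tuple T * n.-tuple T -> \bar R) : measurable_fun setT f ->
  \int[P]_w f (sample n X w, X' w) = \int[Q]_v f (pt (copy 0) v, pt (copy 1) v).
Proof.
move=> mf.
transitivity (\int[distribution P pairP]_p f p).
  by rewrite integral_distribution_measurable.
transitivity (\int[distribution Q pairQ]_p f p); last first.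
  by rewrite integral_distribution_measurable.
transitivity (\int[nu \x nu]_p f p).
  apply: eq_measure_integral => B mB _; apply/esym.
  apply: (@product_measure_unique _ _ _ _ _ nu nu (distribution P pairP)) => // A1 A2 mA1 mA2.
  have [same indep] := copyX'.
  rewrite -[LHS]/(P (sample n X @^-1` A1 `&` X' @^-1` A2)) indep//.
  by congr (_ * _); exact/esym/same.
apply: eq_measure_integral => B mB _.
apply: (@product_measure_unique _ _ _ _ _ nu nu (distribution Q pairQ)) => // A1 A2 mA1 mA2.
pose r c (k : 'I_n) : I := (c, k).
have ir c : injective (r c) by move=> k k' [].
have iv : injective (fun k : 'I_n => val k) by exact: val_inj.
have mc (A : set (n.-tuple T)) : measurable A ->
    measurable (coords id @^-1` A : set (pathspace T 'I_n)).
  move=> mA; rewrite -[X in measurable X]setTI; exact: measurable_coords.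
have := law_block iidX place_inj (ir 0%N) (ir 1%N) iv iv _ (mc _ mA1) (mc _ mA2).
move=> /(_ (fun _ _ => isT)) E.
rewrite -[LHS]/(Q (shift (r 0%N) @^-1` (coords id @^-1` A1) `&`
                   shift (r 1%N) @^-1` (coords id @^-1` A2))) E.
by [].
Qed.

End Transfer.

Section Affine.
Context {R : realType} {dT : measure_display} {T : measurableType dT} {n : nat}.
Context (f : n.-tuple T -> R) (m sigma : R).
Hypothesis sigma_gt0 : 0 < sigma.

Let g x := (f x - m) / sigma.

Lemma Delta_affine j x x' : Delta g j x x' = Delta f j x x' / sigma.
Proof. by rewrite /Delta /g -mulrBl opprB addrA subrK. Qed.

Lemma maxDelta_affine x x' : maxDelta g x x' = maxDelta f x x' / sigma.
Proof.
have si0 : 0 <= sigma^-1 by rewrite invr_ge0 ltW.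
rewrite /maxDelta (big_morph (fun y => y / sigma) (id1 := 0) (op1 := Num.max)).
- by apply: eq_bigr => j _; rewrite Delta_affine normrM (ger0_norm si0).
- by move=> y z; rewrite maxr_pMl.
- by rewrite mul0r.
Qed.

Lemma interaction_rule_affine (G : graphical_rule T n) :
  interaction_rule f G -> interaction_rule g G.
Proof.
move=> ruleG x x' i j ij e1 e2 e3 e4; have := ruleG x x' i j ij e1 e2 e3 e4.
rewrite /noninteracting /g => fE.
have E a b : (a - m) / sigma - (b - m) / sigma = (a - b) / sigma.
  by rewrite -mulrBl opprB addrA subrK.
by rewrite !E fE.
Qed.

End Affine.

Lemma sqrt_sqrt_powR {R : realType} (x : R) : 0 <= x ->
  Num.sqrt (Num.sqrt x) = x `^ 4^-1.
Proof.
move=> x0; rewrite -powR12_sqrt ?sqrtr_ge0// -powR12_sqrt// -powRrM.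
by congr (_ `^ _); field.
Qed.

Local Open Scope ereal_scope.

Theorem theorem2p5 (R : realType) :
  exists C : R,
  forall (dT : measure_display) (T : measurableType dT) (n : nat)
    (f : {mfun n.-tuple T >-> R})
    (G : graphical_rule T n) (G' : graphical_rule T n.+4)
    (d : measure_display) (Omega : measurableType d) (P : probability Omega R)
    (X : nat -> {RV P >-> T}) (X' : {RV P >-> n.-tuple T}),
  (1 <= n)%N ->
  symmetric_rule G ->
  interaction_rule f G ->
  symmetric_rule G' ->
  extension G G' ->
  iid X ->
  independent_copy (sample n X) X' ->
  let W : {RV P >-> R} := f \o sample n X in
  0 < 'V_P[W] < +oo ->
  let sigma : R := Num.sqrt (fine 'V_P[W]) in
  let D (j : 'I_n) : Omega -> R := fun w => Delta f j (sample n X w) (X' w) in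
  let M : Omega -> R := fun w => maxDelta f (sample n X w) (X' w) in
  let delta : Omega -> R :=
    fun w => (1 + degree (G' (sample n.+4 X w)) ord0)%N%:R in
  distance_to_normality W <=
    (C * Num.sqrt n%:R / sigma ^+ 2)%:E
      * 'E_P[fun w => (M w ^+ 8)%R] `^ (4^-1)
      * 'E_P[fun w => (delta w ^+ 4)%R] `^ (4^-1)
    + (2 * sigma ^+ 3)^-1%:E
      * \sum_(j < n) 'E_P[fun w => (`|D j w| ^+ 3)%R].
Proof.
exists 40%R => dT T n f G G' d Omega P X X' n0 symG ruleG symG' extG iidX copyX' W.
move=> /andP[V0 Voo].
pose sigma : R := Num.sqrt (fine 'V_P[W]).
pose D (j : 'I_n) : Omega -> R := fun w => Delta f j (sample n X w) (X' w).
pose M : Omega -> R := fun w => maxDelta f (sample n X w) (X' w).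
pose delta : Omega -> R := fun w => (1 + degree (G' (sample n.+4 X w)) ord0)%N%:R.
change (is_true (distance_to_normality W <=
    (40 * Num.sqrt n%:R / sigma ^+ 2)%:E
      * 'E_P[fun w => (M w ^+ 8)%R] `^ (4^-1)
      * 'E_P[fun w => (delta w ^+ 4)%R] `^ (4^-1)
    + (2 * sigma ^+ 3)^-1%:E
      * \sum_(j < n) 'E_P[fun w => (`|D j w| ^+ 3)%R])).
pose i0 : 'I_n := Ordinal n0.
(* One injective choice of [n + 4] indices, to express the moment of [delta] on the space of
   copies. *)
pose s := fresh4 i0; have ins : injective s by exact: fresh4_inj.
pose Q := law X (@place n).
have iidQ : iid_copies Q by exact: law_iid_copies.
pose m := fine 'E_P[W].
have mf : measurable_fun setT f by exact: measurable_funP.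
pose zero (k : 'I_n) : nat * 'I_n := (0%N, k).
have inz : injective zero by move=> k k' [].
have to0 (F : n.-tuple T -> \bar R) : measurable_fun setT F ->
    \int[P]_w F (sample n X w) = \int[Q]_v F (pt (copy 0) v).
  by move=> mF; rewrite (integral_sample iidX inz mF).
have to01 (F : n.-tuple T * n.-tuple T -> \bar R) : measurable_fun setT F ->
    \int[P]_w F (sample n X w, X' w) = \int[Q]_v F (pt (copy 0) v, pt (copy 1) v).
  by move=> mF; rewrite (integral_pair iidX copyX' mF).
have Vfin : 'V_P[W] \is a fin_num by rewrite ge0_fin_numE// variance_ge0.
have fV0 : (0 < fine 'V_P[W])%R by rewrite fine_gt0// V0.
have sigma0 : (0 < sigma)%R by rewrite sqrtr_gt0.
have sigma2 : (sigma ^+ 2 = fine 'V_P[W])%R by rewrite sqr_sqrtr// ltW.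
have mfm : measurable_fun setT (fun x => (f x - m) ^+ 2)%R.
  by apply: measurable_funX; exact: measurable_funB.
have QV : \int[Q]_v ((f (pt (copy 0) v) - m) ^+ 2)%:E = 'V_P[W].
  rewrite -(to0 (fun x => ((f x - m) ^+ 2)%:E)); last exact/measurable_EFinP.
  by rewrite /variance unlock -/m unlock.
have Lfm : L2 Q (fun v => f (pt (copy 0) v) - m)%R.
  have mfv : measurable_fun setT
      (fun v : pathspace T (nat * 'I_n)%type => f (pt (copy 0) v) - m)%R.
    apply: measurable_funB => //.
    by apply: (measurableT_comp mf); exact: measurable_pt.
  split=> //; apply/integrableP; split.
    by apply/measurable_EFinP; exact: measurable_funX.
  under eq_integral do rewrite /= ger0_norm ?sqr_ge0//.
  by rewrite QV.
pose g x := ((f x - m) / sigma)%R.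
have mg : measurable_fun setT g.
  by apply: measurable_funM => //; exact: measurable_funB.
have Lg : L2 Q (fun v => g (pt (copy 0) v)).
  by under eq_L2 do rewrite /g mulrC; exact: L2Z.
have Eg : Ex Q (fun v => g (pt (copy 0) v)) = 0%R.
  under eq_Ex do rewrite /g mulrC.
  rewrite ExZ; last exact: L2_integ.
  have -> : Ex Q (fun v => f (pt (copy 0) v) - m)%R = 0%R; last by rewrite mulr0.
  (* A priori [m] is only the [fine] part of the expectation. Finite variance makes [f - m] square
     integrable, hence [f] integrable, and [m] is the true mean. *)
  have ifv : integ Q (fun v => f (pt (copy 0) v)).
    under eq_integ do rewrite -[f _](subrK m).
    by apply: integD; [exact: L2_integ|exact: integ_cst].
  rewrite ExB ?Ex_cst//; last exact: integ_cst.
  rewrite /Ex /Rintegral -(to0 (EFin \o f)); last exact/measurable_EFinP.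
  by rewrite /m expectation_def subrr.
have Eg2 : Ex Q (fun v => g (pt (copy 0) v) ^+ 2)%R = 1%R.
  under eq_Ex do rewrite /g mulrC exprMn.
  rewrite ExZ; last exact: Lfm.2.
  rewrite /Ex /Rintegral QV exprVn sigma2 mulVf// gt_eqF//.
have ruleg : interaction_rule g G by exact: interaction_rule_affine.
pose d4 := Ex Q (fun v => (1 + degree (G' (coords s v)) ord0)%N%:R ^+ 4)%R.
have d4_ge1 : (1 <= d4)%R by exact: Ex_degree_ge1.
have Ed4 : 'E_P[fun w => (delta w ^+ 4)%R] = d4%:E.
  rewrite unlock /delta /d4 /Ex /Rintegral fineK; last first.
    by apply: integrable_fin_num => //; exact: integ_degree.
  apply: (integral_sample iidX ins (f := fun y => ((1 + degree (G' y) ord0)%N%:R ^+ 4)%:E)).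
  apply/measurable_EFinP; apply: measurable_funX.
  rewrite (_ : (fun x => _) = fun x => 1 + (degree (G' x) ord0)%:R)%R; last first.
    by apply/funext => x; rewrite natrD.
  by apply: measurable_funD => //; exact: measurable_degree.
have mM8 : measurable_fun setT
    (fun p : n.-tuple T * n.-tuple T => ((maxDelta f p.1 p.2) ^+ 8)%:E).
  by apply/measurable_EFinP; apply: measurable_funX; exact: measurable_maxDelta.
have EM8 : 'E_P[fun w => (M w ^+ 8)%R] =
    \int[Q]_v (maxDelta f (pt (copy 0) v) (pt (copy 1) v) ^+ 8)%:E.
  by rewrite unlock; exact: (to01 (fun p => ((maxDelta f p.1 p.2) ^+ 8)%:E)).
have EM0 : 0 <= 'E_P[fun w => (M w ^+ 8)%R].
  by apply: expectation_ge0 => w; rewrite exprn_ge0// maxDelta_ge0.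
have ED0 j : 0 <= 'E_P[fun w => (`|D j w| ^+ 3)%R].
  by apply: expectation_ge0 => w; rewrite exprn_ge0.
have sqn0 : (0 < Num.sqrt n%:R :> R)%R by rewrite sqrtr_gt0 ltr0n.
have C0 : (0 < 40 * Num.sqrt n%:R / sigma ^+ 2)%R.
  by rewrite divr_gt0 ?exprn_gt0// mulr_gt0.
(* If the eighth moment is infinite, so is the right-hand side: the factors multiplying it are
   positive, the last one because [d4 >= 1]. *)
have [Moo|Mfin] := eqVneq 'E_P[fun w => (M w ^+ 8)%R] +oo.
  rewrite Moo poweRyr// gt0_muley ?lte_fin// Ed4 poweR_EFin gt0_mulye ?lte_fin; last first.
    by rewrite powR_gt0// (lt_le_trans ltr01).
  rewrite addye ?leey// gt_eqF// (lt_le_trans (ltNyr 0))// mule_ge0//.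
    by rewrite lee_fin invr_ge0 mulr_ge0// exprn_ge0// ltW.
  by apply: sume_ge0 => j _.
have iM8f : integ Q (fun v => maxDelta f (pt (copy 0) v) (pt (copy 1) v) ^+ 8)%R.
  apply/integrableP; split.
    apply/measurable_EFinP; apply: measurable_funX.
    exact: (measurable_pair (measurable_maxDelta mf)).
  under eq_integral do rewrite /= ger0_norm ?exprn_ge0 ?maxDelta_ge0//.
  by rewrite -EM8 ltey.
pose m8 := Ex Q (fun v => maxDelta f (pt (copy 0) v) (pt (copy 1) v) ^+ 8)%R.
have m8_ge0 : (0 <= m8)%R by apply: Ex_ge0 => v; rewrite exprn_ge0// maxDelta_ge0.
have {}EM8 : 'E_P[fun w => (M w ^+ 8)%R] = m8%:E.
  by rewrite EM8 /m8 /Ex /Rintegral fineK//; exact: integrable_fin_num.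
pose D3 j := Ex Q (fun v => `|Delta f j (pt (copy 0) v) (pt (copy 1) v)| ^+ 3)%R.
have ED3 j : 'E_P[fun w => (`|D j w| ^+ 3)%R] = (D3 j)%:E.
  rewrite unlock /D3 /Ex /Rintegral fineK; last first.
    by apply: integrable_fin_num => //; exact: integ_Delta3.
  apply: (to01 (fun p => (`|Delta f j p.1 p.2| ^+ 3)%:E)).
  apply/measurable_EFinP; apply: measurable_funX; apply: measurableT_comp => //.
  exact: measurable_Delta.
have maxg v : (maxDelta g (pt (copy 0) v) (pt (copy 1) v) ^+ 8 = sigma ^- 8 *
    maxDelta f (pt (copy 0) v) (pt (copy 1) v) ^+ 8)%R.
  by rewrite /g maxDelta_affine// expr_div_n mulrC.
have iM8g : integ Q (fun v => maxDelta g (pt (copy 0) v) (pt (copy 1) v) ^+ 8)%R.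
  by rewrite (eq_integ Q maxg); exact: integZ.
have m8g : Ex Q (fun v => maxDelta g (pt (copy 0) v) (pt (copy 1) v) ^+ 8)%R =
    (sigma ^- 8 * m8)%R.
  by rewrite (eq_Ex Q maxg) ExZ.
have D3g j : Ex Q (fun v => `|Delta g j (pt (copy 0) v) (pt (copy 1) v)| ^+ 3)%R =
    (sigma ^- 3 * D3 j)%R.
  rewrite /D3 -ExZ; last exact: integ_Delta3.
  apply: eq_Ex => v; rewrite /g Delta_affine normrM exprMn mulrC normfV.
  by rewrite (gtr0_norm sigma0) exprVn.
(* Standardizing divides the eighth moment by [sigma ^+ 8], and its fourth root gives the factor
   [sigma ^- 2] of the theorem. *)
have root4 : Num.sqrt (n%:R * Num.sqrt (sigma ^- 8 * m8 * d4)) =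
    (Num.sqrt n%:R / sigma ^+ 2 * m8 `^ 4^-1 * d4 `^ 4^-1)%R.
  have d4_ge0 : (0 <= d4)%R by exact: le_trans d4_ge1.
  rewrite -mulrA sqrtrM ?ler0n//.
  have -> : (sigma ^- 8 = (sigma ^- 4) ^+ 2)%R by rewrite -exprVn -exprVn -exprM.
  rewrite sqrtrM ?sqr_ge0// sqrtr_sqr ger0_norm ?invr_ge0 ?exprn_ge0 ?(ltW sigma0)//.
  have -> : (sigma ^- 4 = (sigma ^- 2) ^+ 2)%R by rewrite -exprVn -exprVn -exprM.
  rewrite sqrtrM ?sqr_ge0// sqrtr_sqr ger0_norm ?invr_ge0 ?exprn_ge0 ?(ltW sigma0)//.
  rewrite sqrt_sqrt_powR; last exact: mulr_ge0.
  by rewrite powRM// !mulrA.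
rewrite EM8 Ed4 (eq_bigr (fun j => (D3 j)%:E)) => [|j _]; last exact: ED3.
rewrite sumEFin !poweR_EFin -!EFinM -EFinD.
apply: ge_ereal_sup => _ [h /lipschitz1P hL <-].
have [ih le_h] := lipschitz_test_le iidQ mg n0 ruleg symG' extG iM8g Lg Eg Eg2 ins hL.
have mh : measurable_fun setT h.
  by apply: continuous_measurable_fun; exact: lipschitz_continuous.
have -> : \int[distribution P (standardize W)]_x (h x)%:E =
    (Ex Q (fun v => h (g (pt (copy 0) v))))%:E.
  rewrite integral_distribution_measurable; last exact/measurable_EFinP.
  rewrite /Ex /Rintegral fineK; last by apply: integrable_fin_num.
  apply: (to0 (fun x => (h (g x))%:E)).
  by apply/measurable_EFinP; exact: measurableT_comp.
have -> : \int[normal_prob 0%R 1%R]_x (h x)%:E =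
    (\int[lebesgue_measure]_t (h t * gauss t))%R%:E.
  rewrite integral_normal_prob// /Rintegral fineK//.
  apply: integrable_fin_num => //.
  rewrite (_ : (fun x => _) = EFin \o (fun t => (h t - 0) * gauss t)%R).
    exact: integrable_lipschitz_gauss.
  by apply/funext => t /=; rewrite subr0.
rewrite -EFinB abse_EFin lee_fin (le_trans le_h)// m8g root4.
rewrite (eq_bigr (fun j => sigma ^- 3 * D3 j)%R) => [|j _]; last exact: D3g.
rewrite -mulr_sumr (invfM 2%R).
by move: (sigma ^- 2)%R (sigma ^- 3)%R => a b; rewrite !mulrA.
Qed.
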